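(* Let $n > 4$ be an integer and let $\varepsilon > 0$. Then there exist a smooth positive function $K$ on $\mathbb{R}^n \setminus \{0\}$ with $|K - 1| \le \varepsilon$ in $\mathbb{R}^n \setminus \{0\}$, which, when extended to $\mathbb{R}^n$ by setting $K(0) = 1$, is a Lipschitz function on $\mathbb{R}^n$ (that is, there is a constant $C > 0$ such that $|K(x) - K(y)| \le C|x-y|$ for all $x, y \in \mathbb{R}^n$), and a smooth positive blow-up solution $u$ of the equation $$\Delta u + n(n-2)\, K\, u^{\frac{n+2}{n-2}} = 0 \quad \text{in } \mathbb{R}^n \setminus \{0\}.$$
   Context: $\Delta$ is the Euclidean Laplacian on $\mathbb{R}^n$. A positive smooth solution $u$ of the equation on $\mathbb{R}^n \setminus \{0\}$ is called a blow-up solution if it does not have slow decay near the origin, i.e. there does not exist a constant $C' > 0$ such that $u(x) \le C' |x|^{\frac{2-n}{2}}$ for all $x \in \mathbb{R}^n \setminus \{0\}$ with $|x|$ close to zero. *)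

(* Defs.v *)
From mathcomp Require Import all_boot all_order all_algebra.
From mathcomp Require Import boolp classical_sets reals topology normedtype.
From mathcomp Require Import derive exp.

Set Implicit Arguments.
Unset Strict Implicit.
Unset Printing Implicit Defensive.

Import Order.TTheory GRing.Theory Num.Theory.
Import numFieldNormedType.Exports.

Local Open Scope classical_set_scope.
Local Open Scope ring_scope.

(* The library norm `|x| on 'rV[R]_n is the sup norm, so the Euclidean norm
   is defined separately. *)
Definition enorm (R : realType) (n : nat) (x : 'rV[R]_n) : R :=
  Num.sqrt (\sum_(i < n) x 0 i ^+ 2).

Definition partial (R : realType) (n : nat) (i : 'I_n) (f : 'rV[R]_n -> R) :
    'rV[R]_n -> R :=
  fun x => 'D_(delta_mx 0 i) f x.

Definition iter_partial (R : realType) (n : nat) (s : seq 'I_n)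
    (f : 'rV[R]_n -> R) : 'rV[R]_n -> R :=
  foldr (@partial R n) f s.

(* C^oo on a set U, meant for U open: partial derivatives of all orders
   (s = [::] gives f itself) exist and are continuous at every point of U.
   Derivability is required explicitly because 'D_v is a total operator. *)
Definition smooth_on (R : realType) (n : nat) (U : set 'rV[R]_n)
    (f : 'rV[R]_n -> R) : Prop :=
  forall (s : seq 'I_n) (x : 'rV[R]_n), U x ->
    {for x, continuous (iter_partial s f)} /\
    (forall i : 'I_n, derivable (iter_partial s f) x (delta_mx 0 i)).

Definition laplacian (R : realType) (n : nat) (f : 'rV[R]_n -> R) :
    'rV[R]_n -> R :=
  fun x => \sum_(i < n) partial i (partial i f) x.

Definition punctured (R : realType) (n : nat) : set 'rV[R]_n :=
  [set x | x != 0].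
Arguments punctured : clear implicits.

Definition slow_decay (R : realType) (n : nat) (u : 'rV[R]_n -> R) : Prop :=
  exists C : R, 0 < C /\
    exists r : R, 0 < r /\
      forall x : 'rV[R]_n, x != 0 -> enorm x < r ->
        u x <= C * enorm x `^ ((2 - n%:R) / 2).

(* Functions on R^n \ {0} are represented by total functions; no clause below
   depends on their value at 0. *)
Definition positive_smooth_solution (R : realType) (n : nat)
    (K u : 'rV[R]_n -> R) : Prop :=
  [/\ smooth_on (punctured R n) u,
      forall x : 'rV[R]_n, x != 0 -> 0 < u x
    & forall x : 'rV[R]_n, x != 0 ->
        laplacian u x
        + n%:R * (n%:R - 2) * K x * u x `^ ((n%:R + 2) / (n%:R - 2)) = 0].

Definition blow_up_solution (R : realType) (n : nat)
    (K u : 'rV[R]_n -> R) : Prop :=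
  positive_smooth_solution K u /\ ~ slow_decay u.

(* Main.v *)
Require Import Defs.
From mathcomp Require Import all_boot all_order all_algebra.
From mathcomp Require Import boolp classical_sets reals topology normedtype.
From mathcomp Require Import derive exp.
From mathcomp Require Import functions constructive_ereal sequences realfun measure.
From mathcomp Require Import lebesgue_measure lebesgue_integral ftc.
From mathcomp Require Import ring lra.

(** A solution is built from explicit pieces, so that the equation serves as
    the definition of [K] and only the Lipschitz bound on [K] has to be earned.

    Write [m = n - 2] and [p = (n + 2) / (n - 2)]. The function
    [background x = (1 + |x|^2)^(- m / 2)] solves the equation with [K = 1] and
    is the conformal factor of the stereographic projection. Hence, if [q] is
    an affine function of [sin^2] of half the spherical distance to a point
    [xi], the Laplacian of [background * h(q)] is again a power of the
    background times a function of [q], and the equation becomes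
    [K = confL h / h^p] with an ordinary differential operator [confL]
    ([laplacian_bubble]). Normalise [q] to run over [[dl, 1 / dl]]; then the
    bubble with concentration [dl] at [xi] is [background * bub(q)] with
    [bub q = q^(- m / 2)].

    For [h = 1 + bub] the cross terms of [(1 + bub)^p] make [K] vary by order
    one around [q = 1], where [bub q] is comparable with [1], that is over a
    distance [sqrt dl]. Therefore [h = 1 + X(dl q) (bub q + dl Ph q)], where the
    correction [Ph] solves the linear equation whose right-hand side is the
    interaction [(1 + bub)^p - 1 - bub^p] ([is_correction]), and the cutoff
    [X] makes [h = 1] away from [xi]. What is left of the defect is of relative
    size [dl] times a function [err] that does not deteriorate as [dl] tends to
    [0], and one gets [|q k'(q)| <= C dl sqrt q] for the curvature [k] as a
    function of [q] ([curv_bound]). Since the gradient of [q] is at most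
    [2 sqrt (q / dl)] ([qgrad_bound]), the Lipschitz constant of [K] is of order
    [sqrt dl]; choosing [dl] small, [K] is [2]-Lipschitz, whatever the size of
    the support of the perturbation and the height of the bubble
    ([radial_profile], [bubble_exists]). The dimension enters through the flux
    of [Ph]: the interaction contributes [q^(m / 2 - 2)] near the centre, which
    is integrable exactly when [m > 2] ([flux_inner]).

    Such perturbations are placed in disjoint balls that shrink to the origin,
    each with a peak much higher than slow decay permits. The bound on [K - 1]
    holds because [K - 1] is Lipschitz and vanishes outside small balls
    ([glued_solution]). *)

Set Implicit Arguments.
Unset Strict Implicit.
Unset Printing Implicit Defensive.

Import Order.TTheory GRing.Theory Num.Theory.
Import numFieldNormedType.Exports.

Local Open Scope ring_scope.

(** * Derivatives along a direction, and smoothness along a frame *)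

Section Directional.
Variables (R : realType) (V : normedModType R).
Implicit Types (f g : V -> R) (x v : V).

Lemma is_derive_ext f g x v (df : R) :
  f =1 g -> is_derive x v f df -> is_derive x v g df.
Proof. by move=> /funext ->. Qed.

Lemma is_derive_cstE (c : R) x v : is_derive x v (fun=> c) 0.
Proof. exact: is_derive_cst. Qed.

Lemma is_derive_add f g x v (df dg : R) :
  is_derive x v f df -> is_derive x v g dg ->
  is_derive x v (fun y => f y + g y) (df + dg).
Proof. by move=> hf hg; exact: (is_deriveD hf hg). Qed.

Lemma is_derive_opp f x v (df : R) :
  is_derive x v f df -> is_derive x v (fun y => - f y) (- df).
Proof. by move=> hf; exact: (is_deriveN hf). Qed.

Lemma is_derive_mul f g x v (df dg : R) :
  is_derive x v f df -> is_derive x v g dg ->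
  is_derive x v (fun y => f y * g y) (df * g x + f x * dg).
Proof.
move=> hf hg; have [H1 H2] := is_deriveM hf hg.
apply: (DeriveDef (H1 : derivable (fun y => f y * g y) x v)).
rewrite (_ : (fun y => f y * g y) = (f * g : V -> R)) // H2.
by rewrite addrC /GRing.scale /= [df * _]mulrC.
Qed.

Lemma is_derive_scale (c : R) f x v (df : R) :
  is_derive x v f df -> is_derive x v (fun y => c * f y) (c * df).
Proof.
move=> hf; have := is_derive_mul (is_derive_cstE c x v) hf.
by rewrite mul0r add0r.
Qed.

Lemma is_derive_exp f (k : nat) x v (df : R) :
  is_derive x v f df ->
  is_derive x v (fun y => f y ^+ k) (k%:R * f x ^+ k.-1 * df).
Proof.
move=> hf; have [H1 H2] := is_deriveX k hf.
have E : (fun y => f y ^+ k) = (f ^+ k : V -> R) by rewrite exprfctE.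
by split; rewrite E.
Qed.

Lemma derive_lineE f x v : 'D_v f x = 'D_1 (fun t : R => f (t *: v + x)) 0.
Proof.
rewrite /derive; set F := (X in fmap X); set G := (X in _ = lim (fmap X _)).
suff -> : F = G by [].
by apply/funext => t; rewrite /F /G /= addr0 scale0r add0r [_%:A]mulr1.
Qed.

Lemma is_derive_line f x v (d : R) :
  is_derive (0 : R) 1 (fun t : R => f (t *: v + x)) d -> is_derive x v f d.
Proof.
move=> [d1 d2]; apply: DeriveDef; first exact/derivable1P.
by rewrite derive_lineE.
Qed.

Lemma is_derive_comp f (g : R -> R) x v (df dg : R) :
  is_derive x v f df -> is_derive (f x) 1 g dg ->
  is_derive x v (fun y => g (f y)) (dg * df).
Proof.
move=> [df1 <-] [dg1 <-].
have df2 := derivableP ((derivable1P _ _ _).1 df1).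
have dg2 : is_derive ((fun t : R => f (t *: v + x)) 0) 1 g ('D_1 g (f x)).
  by rewrite scale0r add0r; exact: derivableP.
have [d E] := is_derive1_comp dg2 df2.
apply: DeriveDef; first exact/derivable1P.
by rewrite !derive_lineE -E.
Qed.

Lemma is_derive_inv f x v (df : R) :
  f x != 0 -> is_derive x v f df ->
  is_derive x v (fun y => (f y)^-1) (- df / f x ^+ 2).
Proof.
move=> f0 hf; have := is_derive_comp hf.
move=> /(_ (fun y => y^-1) (- (f x ^- 2))) H.
apply: is_derive_eq; first apply: H.
  apply: is_derive_eq; first exact: (is_deriveV f0 (is_derive_id (f x) 1)).
  by rewrite /GRing.scale /= mulr1.
by rewrite mulNr mulrC mulNr.
Qed.

Lemma is_derive_powR f (a : R) x v (df : R) :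
  0 < f x -> is_derive x v f df ->
  is_derive x v (fun y => f y `^ a) (a * f x `^ (a - 1) * df).
Proof. by move=> f0 hf; exact: is_derive_comp hf (is_derive1_powR a f0). Qed.

End Directional.

Section Frame.
Variables (R : realType) (V : normedModType R) (I : Type) (e : I -> V).
Implicit Types (f g : V -> R) (U W : set V).

(** Both the coordinate frame of [R^n] and the single vector [1] of the line
    occur as [e]. Continuity is demanded at every order because derivability
    along the vectors of a frame does not imply it. *)
Fixpoint Ck (k : nat) U f : Prop :=
  (forall x, U x -> {for x, continuous f}) /\
  if k is k'.+1 then
    forall i, (forall x, U x -> derivable f x (e i)) /\
              Ck k' U (fun x => 'D_(e i) f x)
  else True.

Definition Coo U f := forall k, Ck k U f.

Lemma Ck_cont k U f : Ck k U f -> forall x, U x -> {for x, continuous f}.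
Proof. by case: k => [|k] []. Qed.

Lemma Ck_le k U f : Ck k.+1 U f -> Ck k U f.
Proof.
elim: k f => [|k IH] f [cf df]; split=> // i.
by have [d1 d2] := df i; split=> //; exact: IH.
Qed.

Lemma Ck_sub k U W f : (W `<=` U)%classic -> Ck k U f -> Ck k W f.
Proof.
move=> WU; elim: k f => [|k IH] f [cf df]; split=> //.
- by move=> x /WU; exact: cf.
- by move=> x /WU; exact: cf.
- move=> i; have [d1 d2] := df i; split; first by move=> x /WU; exact: d1.
  exact: IH.
Qed.

(** The neighbourhoods may depend on [k] and on the point, which is what the
    gluing of infinitely many bubbles provides. *)
Lemma Ck_local k U f :
  (forall x, U x -> exists W, W x /\ Ck k W f) -> Ck k U f.
Proof.
elim: k f => [|k IH] f H.
  by split=> // x /H [W [Wx /Ck_cont]]; exact.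
split; first by move=> x /H [W [Wx /Ck_cont]]; exact.
move=> i; split; first by move=> x /H [W [Wx [_ /(_ i) [+ _]]]]; exact.
apply: IH => x /H [W [Wx [_ /(_ i) [_ ?]]]]; by exists W.
Qed.

Lemma Ck_ext k U f g : open U -> (forall x, U x -> f x = g x) ->
  Ck k U f -> Ck k U g.
Proof.
move=> oU; elim: k f g => [|k IH] f g fg.
  move=> [cf _]; split=> // x Ux.
  have nfg : \near x, f x = g x.
    by apply: filterS (open_nbhs_nbhs (conj oU Ux)) => y; exact: fg.
  rewrite /prop_for /continuous_at -(fg _ Ux); apply: cvg_trans (cf _ Ux).
  exact: near_eq_cvg.
move=> Cf; have [_ df] := Cf.
split; first exact: Ck_cont (IH f g fg (Ck_le Cf)).
move=> i; have [d1 d2] := df i.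
have nfg x : U x -> \near x, f x = g x.
  by move=> Ux; apply: filterS (open_nbhs_nbhs (conj oU Ux)) => y; exact: fg.
split.
  by move=> x Ux; apply: near_eq_derivable (nfg x Ux) (d1 x Ux).
apply: IH d2 => x Ux; exact: near_eq_derive (nfg x Ux).
Qed.

Lemma CkS k U f (f' : I -> V -> R) : open U ->
  (forall x, U x -> {for x, continuous f}) ->
  (forall i x, U x -> is_derive x (e i) f (f' i x)) ->
  (forall i, Ck k U (f' i)) -> Ck k.+1 U f.
Proof.
move=> oU cf df Cf; split=> // i; split.
  by move=> x Ux; have [] := df i x Ux.
apply: Ck_ext (Cf i) => // x Ux; by have [_ ->] := df i x Ux.
Qed.

Lemma CkS_derive k U f i x : Ck k.+1 U f -> U x ->
  is_derive x (e i) f ('D_(e i) f x).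
Proof. by move=> [_ /(_ i) [d _]] /d; exact: derivableP. Qed.

Lemma Ck_cst k U (c : R) : open U -> Ck k U (fun=> c).
Proof.
move=> oU; elim: k c => [|k IH] c; first by split=> // x _; exact: cst_continuous.
apply: (CkS (f' := fun _ _ => 0)) => //.
by move=> x _; exact: cst_continuous.
Qed.

Lemma Ck_add k U f g : open U -> Ck k U f -> Ck k U g ->
  Ck k U (fun x => f x + g x).
Proof.
move=> oU; elim: k f g => [|k IH] f g Cf Cg.
  split=> // x Ux.
  by apply: continuousD; [exact: (Ck_cont Cf)|exact: (Ck_cont Cg)].
apply: (CkS (f' := fun i x => 'D_(e i) f x + 'D_(e i) g x)) => //.
- move=> x Ux.
  by apply: continuousD; [exact: (Ck_cont Cf)|exact: (Ck_cont Cg)].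
- by move=> i x Ux; exact: is_derive_add (CkS_derive i Cf Ux) (CkS_derive i Cg Ux).
- by move=> i; apply: IH; [have [_ /(_ i) []] := Cf|have [_ /(_ i) []] := Cg].
Qed.

Lemma Ck_mul k U f g : open U -> Ck k U f -> Ck k U g ->
  Ck k U (fun x => f x * g x).
Proof.
move=> oU; elim: k f g => [|k IH] f g Cf Cg.
  split=> // x Ux.
  by apply: continuousM; [exact: (Ck_cont Cf)|exact: (Ck_cont Cg)].
apply: (CkS (f' := fun i x => 'D_(e i) f x * g x + f x * 'D_(e i) g x)) => //.
- move=> x Ux.
  by apply: continuousM; [exact: (Ck_cont Cf)|exact: (Ck_cont Cg)].
- by move=> i x Ux; exact: is_derive_mul (CkS_derive i Cf Ux) (CkS_derive i Cg Ux).
- move=> i; apply: Ck_add => //; apply: IH; try exact: Ck_le.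
    by have [_ /(_ i) []] := Cf.
  by have [_ /(_ i) []] := Cg.
Qed.

End Frame.


Section Composition.
Variables (R : realType) (V : normedModType R) (I : Type) (e : I -> V).

Definition Cline (D : set R) (f : R -> R) := Coo (fun _ : unit => (1 : R)) D f.

Lemma Ck_comp k (U : set V) (D : set R) (f : V -> R) (g : R -> R) : open U ->
  (forall x, U x -> D (f x)) -> Ck e k U f -> Ck (fun _ : unit => (1 : R)) k D g ->
  Ck e k U (fun x => g (f x)).
Proof.
move=> oU; elim: k f g => [|k IH] f g fD Cf Cg.
  split=> // x Ux; apply: continuous_comp; first exact: (Ck_cont Cf).
  exact: (Ck_cont Cg) (fD _ Ux).
apply: (CkS (f' := fun i x => 'D_1 g (f x) * 'D_(e i) f x)) => //.
- move=> x Ux; apply: continuous_comp; first exact: (Ck_cont Cf).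
  exact: (Ck_cont Cg) (fD _ Ux).
- move=> i x Ux; exact: is_derive_comp (CkS_derive i Cf Ux)
    (CkS_derive tt Cg (fD _ Ux)).
- move=> i; apply: Ck_mul => //.
    apply: (IH f (fun y => 'D_1 g y)) => //; first exact: Ck_le.
    by have [_ /(_ tt) []] := Cg.
  by have [_ /(_ i) []] := Cf.
Qed.

Lemma Coo_comp (U : set V) (D : set R) (f : V -> R) (g : R -> R) : open U ->
  (forall x, U x -> D (f x)) -> Coo e U f -> Cline D g ->
  Coo e U (fun x => g (f x)).
Proof. move=> oU fD Cf Cg k; exact: Ck_comp (Cf k) (Cg k). Qed.

Lemma Coo_add (U : set V) (f g : V -> R) : open U -> Coo e U f -> Coo e U g ->
  Coo e U (fun x => f x + g x).
Proof. by move=> oU Cf Cg k; exact: Ck_add. Qed.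

Lemma Coo_mul (U : set V) (f g : V -> R) : open U -> Coo e U f -> Coo e U g ->
  Coo e U (fun x => f x * g x).
Proof. by move=> oU Cf Cg k; exact: Ck_mul. Qed.

Lemma Coo_cst (U : set V) (c : R) : open U -> Coo e U (fun=> c).
Proof. by move=> oU k; exact: Ck_cst. Qed.

Lemma Coo_sub (U : set V) (f g : V -> R) : open U -> Coo e U f -> Coo e U g ->
  Coo e U (fun x => f x - g x).
Proof.
move=> oU Cf Cg; apply: Coo_add => // k.
apply: (@Ck_ext _ _ _ _ _ _ (fun x => -1 * g x)) => //.
  by move=> x _; rewrite mulN1r.
by apply: Ck_mul => //; exact: Ck_cst.
Qed.

Lemma Coo_sum (U : set V) (J : Type) (s : seq J) (f : J -> V -> R) : open U ->
  (forall j, Coo e U (f j)) -> Coo e U (fun x => \sum_(j <- s) f j x).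
Proof.
move=> oU Cf; elim: s => [|j s IH] k.
  apply: Ck_ext (Ck_cst _ _ 0 oU) => // x _; by rewrite big_nil.
apply: Ck_ext (Ck_add oU (Cf j k) (IH k)) => // x _; by rewrite big_cons.
Qed.

End Composition.

Section Line.
Variable R : realType.
Implicit Types (f g F : R -> R) (D : set R).

Lemma is_derive_cont f (x d : R) : is_derive x 1 f d -> {for x, continuous f}.
Proof.
by move=> [df _]; apply: differentiable_continuous; exact/derivable1_diffP.
Qed.

Lemma Cline_primitive D f F : open D ->
  (forall x, D x -> is_derive x 1 F (f x)) -> Cline D f -> Cline D F.
Proof.
move=> oD dF Cf [|k].
  by split=> // x /dF /is_derive_cont.
apply: (CkS (f' := fun=> f) oD).
- by move=> x /dF /is_derive_cont.
- by move=> _; exact: Cf.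
Qed.

Lemma Cline_derive D f f' : open D -> Cline D f ->
  (forall x, D x -> is_derive x 1 f (f' x)) -> Cline D f'.
Proof.
move=> oD Cf df k; have [_ /(_ tt) [_]] := Cf k.+1.
by apply: Ck_ext => // x /df [].
Qed.

Lemma Cline_is_derive D f x : Cline D f -> D x -> is_derive x 1 f ('D_1 f x).
Proof. by move=> Cf Dx; exact: (CkS_derive tt (Cf 1%N) Dx). Qed.

Lemma Cline_id D : open D -> Cline D (fun x => x).
Proof.
move=> oD; apply: (Cline_primitive (f := fun=> 1)) => //.
by move=> k; exact: Ck_cst.
Qed.

Lemma Cline_powR (a : R) : Cline [set x | 0 < x]%classic (fun x => x `^ a).
Proof.
move=> k; elim: k a => [|k IH] a.
  by split=> // x x0; exact: is_derive_cont (is_derive1_powR a x0).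
apply: (CkS (f' := fun _ x => a * x `^ (a - 1))).
- exact: open_gt.
- by move=> x x0; exact: is_derive_cont (is_derive1_powR a x0).
- move=> _; apply: (Ck_mul _ _ (IH (a - 1))); first exact: open_gt.
  by apply: Ck_cst; exact: open_gt.
Qed.

End Line.

(** * A smooth cutoff function *)

Section Cutoff.
Variable R : realType.

(** Used at the origin, where [flat k] is not given by a formula. *)
Lemma is_derive_quadratic (f : R -> R) (C : R) :
  (forall x, `|f x| <= C * x ^+ 2) -> is_derive (0 : R) 1 f 0.
Proof.
move=> fC.
have C0 : 0 <= C by have := fC 1; rewrite expr1n mulr1; apply: le_trans.
have f0 : f 0 = 0.
  by apply/eqP; have := fC 0; rewrite expr0n mulr0 normr_le0.
have H : ((fun h : R => h^-1 *: (f (h *: 1 + 0) - f 0)) @ 0^' --> (0 : R))%classic.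
  apply/cvgrPdist_le => e e0.
  have e1 : 0 < e / (C + 1) by rewrite divr_gt0 // ltr_wpDl.
  near=> h; rewrite sub0r normrN f0 subr0 addr0 [_ *: 1]mulr1 normrZ normfV.
  have h0 : 0 < `|h| by rewrite normr_gt0; near: h; exact: nbhs_dnbhs_neq.
  rewrite mulrC ler_pdivrMr //; apply: le_trans (fC h) _.
  rewrite -real_normK ?num_real // expr2 mulrA ler_pM2r //.
  have h1 : `|h| <= e / (C + 1) by near: h; exact: dnbhs0_le.
  apply: (@le_trans _ _ ((C + 1) * (e / (C + 1)))).
    by rewrite ler_pM // lerDl.
  by rewrite mulrC divfK // gt_eqF // ltr_wpDl.
apply: DeriveDef; first by apply/cvg_ex; exists 0.
by apply/cvg_lim; first exact: Rhausdorff.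
Unshelve. all: by end_near. Qed.

(** The derivative of [flat k] is [flat k.+2 - k * flat k.+1], which is why
    all powers of [x^-1] are carried along. *)
Definition flat (k : nat) (x : R) : R :=
  if 0 < x then x^-1 ^+ k * expR (- x^-1) else 0.

Lemma flat_le (k : nat) x : `|flat k x| <= (k.+2)`!%:R * x ^+ 2.
Proof.
rewrite /flat; case: ifPn => [x0|_]; last first.
  by rewrite normr0 mulr_ge0 // ?ler0n // sqr_ge0.
have y0 : 0 < x^-1 by rewrite invr_gt0.
rewrite ger0_norm ?mulr_ge0 ?exprn_ge0 ?expR_ge0 ?(ltW y0) //.
have /(le_trans _) H : x^-1 ^+ k.+2 / (k.+2)`!%:R <= expR x^-1.
  by apply: le_trans _ (expR_ge1Dxn k.+1 (ltW y0)); rewrite lerDr ler01.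
have := H _ (lexx _); rewrite ler_pdivrMr ?ltr0n ?fact_gt0 // expRN => {}H.
rewrite ler_pdivrMr ?expR_gt0 //.
rewrite -(@ler_pM2r _ (x^-1 ^+ 2)) ?exprn_gt0 // -exprD addn2.
apply: le_trans H _; rewrite le_eqVlt; apply/orP; left; apply/eqP.
by rewrite exprVn; field; rewrite gt_eqF.
Qed.

Lemma is_derive_flat (k : nat) (x : R) :
  is_derive x 1 (flat k) (flat k.+2 x - k%:R * flat k.+1 x).
Proof.
have [x0|x0|<-] := ltgtP 0 x; last first.
- apply: is_derive_eq; first exact: is_derive_quadratic (flat_le k).
  by rewrite /flat ltxx mulr0 subrr.
- rewrite /flat ltNge (ltW x0) /= mulr0 subr0.
  apply: near_eq_is_derive _ (is_derive_cstE (0 : R) x 1).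
  near=> y; have y0 : y < 0 by near: y; exact: lt_nbhsl.
  by rewrite ltNge (ltW y0).
- have dI : is_derive x 1 (fun y : R => y^-1) (- x^-1 ^+ 2).
    apply: is_derive_eq.
      exact: is_derive_inv (lt0r_neq0 x0) (is_derive_id x (1 : R)).
    by rewrite mulNr mul1r exprVn.
  have dE : is_derive x 1 (fun y => expR (- y^-1)) (expR (- x^-1) * x^-1 ^+ 2).
    have := is_derive_comp (is_derive_opp dI) (is_derive_expR (- x^-1)).
    by rewrite opprK.
  have dX : is_derive x 1 (fun y : R => y^-1 ^+ k)
                          (- k%:R * x^-1 ^+ k.-1 * x^-1 ^+ 2).
    by apply: is_derive_eq; [exact: is_derive_exp dI|ring].
  have d := is_derive_mul dX dE; apply: is_derive_eq.
    apply: near_eq_is_derive _ d.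
    near=> y; have y0 : 0 < y by near: y; exact: lt_nbhsr.
    by rewrite /flat y0.
  rewrite /flat x0; case: k {dX d} => [|k]; first by rewrite !mul0r oppr0; ring.
  by rewrite /= !exprS; ring.
Unshelve. all: by end_near. Qed.

Lemma Cline_flat (k : nat) : Cline setT (flat k).
Proof.
move=> j; elim: j k => [|j IH] k.
  by split=> // x _; exact: is_derive_cont (is_derive_flat k x).
apply: (CkS (f' := fun _ x => flat k.+2 x + (- k%:R) * flat k.+1 x)).
- exact: openT.
- by move=> x _; exact: is_derive_cont (is_derive_flat k x).
- by move=> _ x _; have := is_derive_flat k x; rewrite mulNr.
- move=> _; apply: Ck_add (openT) (IH _) _; apply: Ck_mul (openT) _ (IH _).
  exact: Ck_cst (openT).
Qed.

End Cutoff.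

Section CutoffLine.
Variable R : realType.

Lemma Cline_comp (D E : set R) (f g : R -> R) : open D ->
  (forall x, D x -> E (f x)) -> Cline D f -> Cline E g ->
  Cline D (fun x => g (f x)).
Proof. exact: Coo_comp. Qed.

Lemma smooth_cutoff (a b : R) : a < b -> exists X : R -> R,
  [/\ Cline setT X, forall x, x <= a -> X x = 1 & forall x, b <= x -> X x = 0].
Proof.
move=> ab.
pose f x := flat 0 (b - x); pose g x := flat 0 (x - a).
have fge0 x : 0 <= f x.
  by rewrite /f /flat; case: ifP => // _; rewrite expr0 mul1r expR_ge0.
have gge0 x : 0 <= g x.
  by rewrite /g /flat; case: ifP => // _; rewrite expr0 mul1r expR_ge0.
have flat_gt0 (x : R) : 0 < x -> 0 < flat 0 x.
  by rewrite /flat => ->; rewrite expr0 mul1r expR_gt0.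
have fg x : 0 < f x + g x.
  have [xb|bx] := ltP x b.
    by rewrite ltr_pwDl // flat_gt0 // subr_gt0.
  by rewrite ltr_wpDl // flat_gt0 // subr_gt0 (lt_le_trans ab).
have Cf : Cline setT f.
  apply: (Cline_comp (f := fun x => b - x) openT _ _ (@Cline_flat R 0)) => //.
  exact: Coo_sub openT (Coo_cst _ b openT) (Cline_id openT).
have Cg : Cline setT g.
  apply: (Cline_comp (f := fun x => x - a) openT _ _ (@Cline_flat R 0)) => //.
  exact: Coo_sub openT (Cline_id openT) (Coo_cst _ a openT).
exists (fun x => f x * (f x + g x) `^ (-1)); split.
- apply: Coo_mul => //; first exact: openT.
  apply: (Cline_comp (f := fun x => f x + g x) openT _ _ (@Cline_powR R (-1))).
    by move=> x _; exact: fg.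
  exact: Coo_add openT Cf Cg.
- move=> x xa; have g0 : g x = 0 by rewrite /g /flat subr_gt0 ltNge xa.
  have fx : 0 < f x by have := fg x; rewrite g0 addr0.
  by rewrite g0 addr0 powR_inv1 ?mulfV // ?gt_eqF // ltW.
- by move=> x bx; rewrite /f /flat subr_gt0 ltNge bx mul0r.
Qed.

(** The base point [a] of the integral is kept away from the domain where the
    derivative is wanted; a shift by a constant makes the primitive vanish at
    any chosen point. *)
Lemma primitive_exists (a b : R) (f : R -> R) : a < b ->
  (forall x, a <= x -> {for x, continuous f}) ->
  exists F : R -> R, F b = 0 /\ forall x, a < x -> is_derive x 1 F (f x).
Proof.
move=> ab cf.
pose F0 x := (\int[@lebesgue_measure R]_(t in [set` `[a, x]]) (f t))%R.
have dF0 x : a < x -> is_derive x 1 F0 (f x).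
  move=> ax; have ai : (@lebesgue_measure R).-integrable `[a, x + 1]%classic (EFin \o f).
    apply: continuous_compact_integrable; first exact: segment_compact.
    apply: continuous_in_subspaceT => y; rewrite inE /= in_itv /= => /andP[ay _].
    exact: cf.
  have [d1 d2] := continuous_FTC1_closed (ltr_pwDr ltr01 (lexx x)) ai ax (cf _ (ltW ax)).
  by apply: DeriveDef; [exact: d1|rewrite -derive1E; exact: d2].
exists (fun x => F0 x - F0 b); split; first by rewrite subrr.
move=> x ax; apply: is_derive_eq.
  exact: is_derive_add (dF0 _ ax) (is_derive_cstE (- F0 b) x 1).
by rewrite addr0.
Qed.

End CutoffLine.

(** * Scale-invariant bounds on a function and its logarithmic derivative *)

Section ScaledBound.
Variable R : realType.
Implicit Types (f g : R -> R) (q a b c s : R).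

(** Bounding [q * f' q] rather than [f' q] makes the bounds of products and
    powers multiply like the bounds of the functions themselves. *)
Definition sbound q a f :=
  exists d, [/\ is_derive q 1 f d, `|f q| <= a & `|q * d| <= a].

Lemma sbound_ge0 q a f : sbound q a f -> 0 <= a.
Proof. by move=> [d [_ + _]]; apply: le_trans. Qed.

Lemma sbound_abs q a f : sbound q a f -> `|f q| <= a.
Proof. by move=> [d []]. Qed.

Lemma sbound_le q a b f : a <= b -> sbound q a f -> sbound q b f.
Proof.
by move=> ab [d [df f1 f2]]; exists d; split=> //; apply: le_trans ab.
Qed.

Lemma sbound_near q a f g : (\near q, f q = g q) -> sbound q a f ->
  sbound q a g.
Proof.
move=> fg [d [df f1 f2]]; exists d; split => //.
  exact: near_eq_is_derive fg df.
by rewrite -(nbhs_singleton fg).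
Qed.

Lemma sbound_ext q a f g : 0 < q -> (forall y, 0 < y -> f y = g y) ->
  sbound q a f -> sbound q a g.
Proof.
move=> q0 fg; apply: sbound_near; near=> y; apply: fg.
by near: y; exact: lt_nbhsr.
Unshelve. all: by end_near. Qed.

Lemma sbound_cst q a c : `|c| <= a -> sbound q a (fun=> c).
Proof.
move=> ca; exists 0; split=> //; first exact: is_derive_cstE.
by rewrite mulr0 normr0 (le_trans _ ca).
Qed.

Lemma sbound_id q : 0 < q -> sbound q q (fun y => y).
Proof.
move=> q0; exists 1; split; first exact: is_derive_id.
  by rewrite gtr0_norm.
by rewrite mulr1 gtr0_norm.
Qed.

Lemma sbound_add q a b f g : sbound q a f -> sbound q b g ->
  sbound q (a + b) (fun y => f y + g y).
Proof.
move=> [d [df f1 f2]] [e [dg g1 g2]]; exists (d + e); split.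
- exact: is_derive_add.
- by apply: le_trans (ler_normD _ _) _; rewrite lerD.
- by rewrite mulrDr; apply: le_trans (ler_normD _ _) _; rewrite lerD.
Qed.

Lemma sbound_scale q a c f : sbound q a f ->
  sbound q (`|c| * a) (fun y => c * f y).
Proof.
move=> [d [df f1 f2]]; exists (c * d); split.
- exact: is_derive_scale.
- by rewrite normrM ler_wpM2l.
- by rewrite mulrCA normrM ler_wpM2l.
Qed.

Lemma sbound_opp q a f : sbound q a f -> sbound q a (fun y => - f y).
Proof.
move=> [d [df f1 f2]]; exists (- d); split; rewrite ?mulrN ?normrN //.
exact: is_derive_opp.
Qed.

Lemma sbound_mul q a b f g : sbound q a f -> sbound q b g ->
  sbound q (2 * (a * b)) (fun y => f y * g y).
Proof.
move=> hf hg; have a0 := sbound_ge0 hf; have b0 := sbound_ge0 hg.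
case: hf hg => [d [df f1 f2]] [e [dg g1 g2]].
exists (d * g q + f q * e); split.
- exact: is_derive_mul.
- rewrite normrM; apply: le_trans (ler_pM _ _ f1 g1) _ => //.
  by rewrite ler_peMl ?mulr_ge0 // ler1n.
- have -> : q * (d * g q + f q * e) = q * d * g q + f q * (q * e) by ring.
  apply: le_trans (ler_normD _ _) _.
  rewrite (normrM (q * d)) (normrM (f q)).
  have -> : 2 * (a * b) = a * b + a * b by ring.
  by rewrite lerD // ler_pM.
Qed.

Lemma sbound_powR q s : 0 < q ->
  sbound q ((1 + `|s|) * q `^ s) (fun y => y `^ s).
Proof.
move=> q0; exists (s * q `^ (s - 1)); split.
- exact: is_derive1_powR.
- by rewrite ger0_norm ?powR_ge0 // ler_peMl ?powR_ge0 // lerDl.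
- have -> : q * (s * q `^ (s - 1)) = s * q `^ s.
    rewrite powRB ?(gt_eqF q0) ?implybT // powRr1 ?(ltW q0) //.
    by field; rewrite gt_eqF.
  by rewrite normrM (ger0_norm (powR_ge0 _ _)) ler_wpM2r ?powR_ge0 // lerDr.
Qed.

(** For a negative exponent the inverse of the base lies in the same
    interval. *)
Lemma powR_half_two (t : R) s : 2^-1 <= t <= 2 -> t `^ s <= 2 `^ `|s|.
Proof.
move=> /andP[t1 t2]; have t0 : 0 < t by lra.
have [s0|s0] := leP 0 s.
  rewrite (ger0_norm s0) ge0_ler_powR ?nnegrE ?(ltW t0) //.
rewrite (ltr0_norm s0) -[s in leLHS]opprK powRN -powR_inv1 ?powR_ge0 //.
have s1 : 0 <= - s by rewrite oppr_ge0 ltW.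
rewrite -powRrM mulrC powRrM powR_inv1 ?(ltW t0) //.
rewrite ge0_ler_powR ?nnegrE ?invr_ge0 ?(ltW t0) //.
by rewrite -[leRHS]invrK lef_pV2 ?posrE ?invr_gt0.
Qed.

Definition pow_const s := `|s| * 2 `^ `|s - 1|.

Lemma pow_const_ge0 s : 0 <= pow_const s.
Proof. by rewrite mulr_ge0 ?powR_ge0. Qed.

Lemma is_derive_1powR (y : R) s : - 1 < y ->
  is_derive y 1 (fun t => (1 + t) `^ s) (s * (1 + y) `^ (s - 1)).
Proof.
move=> y1.
have d1 := is_derive_add (is_derive_cstE (1 : R) y (1 : R)) (is_derive_id y 1).
have y1' : 0 < 1 + y by lra.
by have := is_derive_powR s y1' d1; rewrite add0r mulr1.
Qed.

(** Both [g - f] and [g + f] are nondecreasing. *)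
Lemma growth_comparison (f g df dg : R -> R) a b : a <= b ->
  (forall x, a <= x <= b -> is_derive x 1 f (df x)) ->
  (forall x, a <= x <= b -> is_derive x 1 g (dg x)) ->
  (forall x, a <= x <= b -> `|df x| <= dg x) ->
  `|f b - f a| <= g b - g a.
Proof.
move=> ab Df Dg fg.
have mono (h dh : R -> R) : (forall x, a <= x <= b -> is_derive x 1 h (dh x)) ->
    (forall x, a <= x <= b -> 0 <= dh x) -> h a <= h b.
  move=> Dh h0; have [x||c] := MVT_segment ab (f := h) (df := dh).
  - by rewrite in_itv /= => /andP[ax xb]; apply: Dh; rewrite !ltW.
  - apply: derivable_within_continuous => x; rewrite in_itv /= => /Dh [] //.
  - rewrite in_itv /= => /h0 c0 E; rewrite -subr_ge0 E mulr_ge0 // subr_ge0 //.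
rewrite ler_norml; apply/andP; split.
- suff : g a + f a <= g b + f b by lra.
  apply: (mono (fun x => g x + f x) (fun x => dg x + df x)) => x xab.
    exact: is_derive_add (Dg x xab) (Df x xab).
  by have := fg x xab; rewrite ler_norml => /andP[]; lra.
- suff : g a - f a <= g b - f b by lra.
  apply: (mono (fun x => g x - f x) (fun x => dg x - df x)) => x xab.
    exact: is_derive_add (Dg x xab) (is_derive_opp (Df x xab)).
  by have := fg x xab; rewrite ler_norml => /andP[]; lra.
Qed.

Lemma powR_1p_lipschitz (y : R) s : - 2^-1 <= y <= 1 ->
  `|(1 + y) `^ s - 1| <= pow_const s * `|y|.
Proof.
move=> /andP[y1 y2].
pose df t := s * (1 + t) `^ (s - 1).
have B (t : R) : - 2^-1 <= t <= 1 -> `|df t| <= pow_const s.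
  move=> /andP[t1 t2]; rewrite /df normrM ler_wpM2l //.
  rewrite ger0_norm ?powR_ge0 //; apply: powR_half_two; apply/andP; split; lra.
have D (t : R) : - 2^-1 <= t -> is_derive t 1 (fun t => (1 + t) `^ s) (df t).
  by move=> t1; apply: is_derive_1powR; lra.
(* Instance search finds this derivative of the comparison function below. *)
have L (t : R) : is_derive t 1 (fun t => pow_const s * t) (pow_const s).
  have := is_derive_scale (pow_const s) (is_derive_id t (1 : R)).
  by rewrite mulr1.
have [y0|y0] := leP 0 y.
- have := growth_comparison y0 (f := fun t => (1 + t) `^ s)
    (g := fun t => pow_const s * t) (df := df) (dg := fun=> pow_const s).
  rewrite addr0 powR1 mulr0 subr0 (ger0_norm y0); apply=> // t /andP[t0 ty].
    by apply: D; lra.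
  by apply: B; lra.
- have := growth_comparison (ltW y0) (f := fun t => (1 + t) `^ s)
    (g := fun t => pow_const s * t) (df := df) (dg := fun=> pow_const s).
  rewrite addr0 powR1 mulr0 sub0r -mulrN (ltr0_norm y0) distrC.
  apply=> // t /andP[ty t0].
    by apply: D; lra.
  by apply: B; lra.
Qed.

Lemma sbound_1powR q a f s : sbound q a f -> - 2^-1 <= f q <= 1 ->
  sbound q (pow_const s * a) (fun y => (1 + f y) `^ s - 1).
Proof.
move=> [d [df f1 f2]] fq; exists (s * (1 + f q) `^ (s - 1) * d); split.
- have fq1 : - 1 < f q by case/andP: fq => fq _; apply: lt_le_trans fq; lra.
  have d1 := is_derive_comp df (is_derive_1powR s fq1).
  have := is_derive_add d1 (is_derive_cstE (- 1 : R) q (1 : R)).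
  by rewrite addr0.
- apply: le_trans (powR_1p_lipschitz s fq) _.
  by rewrite ler_wpM2l // pow_const_ge0.
- rewrite mulrCA normrM; apply: ler_pM => //.
  rewrite normrM ler_wpM2l // ger0_norm ?powR_ge0 //.
  apply: powR_half_two; case/andP: fq => ? ?; apply/andP; split; lra.
Qed.

(** The quotients that express the curvature are perturbations of [1] of this
    shape. *)
Lemma sbound_quotient q a f g s : a <= 2^-1 -> sbound q a f -> sbound q a g ->
  sbound q ((1 + 3 * pow_const s) * a)
           (fun y => (1 + f y) * (1 + g y) `^ s - 1).
Proof.
move=> a1 hf hg; have a0 := sbound_ge0 hf.
have gq : - 2^-1 <= g q <= 1.
  have := sbound_abs hg; rewrite ler_norml => /andP[g1 g2].
  by apply/andP; split; lra.
have hp := sbound_1powR s hg gq.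
apply: (sbound_near (f := fun y => f y +
  (((1 + g y) `^ s - 1) + f y * ((1 + g y) `^ s - 1)))).
  by near=> y; ring.
apply: sbound_le (sbound_add hf (sbound_add hp (sbound_mul hf hp))).
have := pow_const_ge0 s; set C := pow_const s => C0.
have : C * (a * a) <= C * (2^-1 * a) by rewrite ler_wpM2l // ler_wpM2r.
by nra.
Unshelve. all: by end_near. Qed.

End ScaledBound.

(** * Uniform bounds for families of functions *)

Section UniformBound.
Variables (R : realType) (J : Type) (D : J -> R -> Prop).
Hypothesis D_gt0 : forall j q, D j q -> 0 < q.
Implicit Types (w f g : J -> R -> R).

(** The constant is uniform in the parameter [j], which will be the
    concentration parameter of a bubble. *)
Definition ubound w f := exists C, 0 <= C /\
  forall j q, D j q -> sbound q (C * w j q) (f j).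

Lemma ubound_le w w' f : (forall j q, D j q -> w j q <= w' j q) ->
  ubound w f -> ubound w' f.
Proof.
move=> ww' [C [C0 H]]; exists C; split=> // j q Dq.
by apply: sbound_le (H _ _ Dq); rewrite ler_wpM2l // ww'.
Qed.

Lemma ubound_ext w f g :
  (forall j q y, D j q -> 0 < y -> f j y = g j y) -> ubound w f -> ubound w g.
Proof.
move=> fg [C [C0 H]]; exists C; split=> // j q Dq.
by apply: sbound_ext (H _ _ Dq); [exact: D_gt0 Dq|move=> y; exact: fg Dq].
Qed.

Lemma ubound_add w f g : ubound w f -> ubound w g ->
  ubound w (fun j y => f j y + g j y).
Proof.
move=> [C [C0 H]] [C' [C0' H']]; exists (C + C'); split; first exact: addr_ge0.
by move=> j q Dq; rewrite mulrDl; apply: sbound_add; [exact: H|exact: H'].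
Qed.

Lemma ubound_opp w f : ubound w f -> ubound w (fun j y => - f j y).
Proof.
move=> [C [C0 H]]; exists C; split=> // j q Dq.
by apply: sbound_opp; exact: H.
Qed.

Lemma ubound_sub w f g : ubound w f -> ubound w g ->
  ubound w (fun j y => f j y - g j y).
Proof. by move=> hf /ubound_opp; exact: ubound_add. Qed.

Lemma ubound_mul w w' f g : ubound w f -> ubound w' g ->
  ubound (fun j q => w j q * w' j q) (fun j y => f j y * g j y).
Proof.
move=> [C [C0 H]] [C' [C0' H']]; exists (2 * (C * C')); split.
  by rewrite !mulr_ge0.
move=> j q Dq.
have -> : 2 * (C * C') * (w j q * w' j q) = 2 * ((C * w j q) * (C' * w' j q)).
  by ring.
by apply: sbound_mul; [exact: H|exact: H'].
Qed.

Lemma ubound_cst w (c : J -> R) (C : R) : 0 <= C ->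
  (forall j q, D j q -> `|c j| <= C * w j q) -> ubound w (fun j _ => c j).
Proof.
by move=> C0 H; exists C; split=> // j q Dq; apply: sbound_cst; exact: H Dq.
Qed.

Lemma ubound_scale w f (c : R) : ubound w f -> ubound w (fun j y => c * f j y).
Proof.
move=> [C [C0 H]]; exists (`|c| * C); split; first exact: mulr_ge0.
by move=> j q Dq; rewrite -mulrA; apply: sbound_scale; exact: H.
Qed.

Lemma ubound_powR (s : R) : ubound (fun _ q => q `^ s) (fun _ y => y `^ s).
Proof.
exists (1 + `|s|); split; first exact: addr_ge0.
by move=> j q Dq; apply: sbound_powR; exact: D_gt0 Dq.
Qed.

Lemma ubound_1powR w f (s : R) : ubound w f ->
  (forall j q, D j q -> - 2^-1 <= f j q <= 1) ->
  ubound w (fun j y => (1 + f j y) `^ s - 1).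
Proof.
move=> [C [C0 H]] fq; exists (pow_const s * C); split.
  by rewrite mulr_ge0 // pow_const_ge0.
move=> j q Dq; rewrite -mulrA; apply: sbound_1powR; first exact: H.
exact: fq.
Qed.

Lemma ubound_derive w f df :
  (exists C, 0 <= C /\ forall j q, D j q ->
     [/\ is_derive q 1 (f j) (df j q), `|f j q| <= C * w j q
       & `|q * df j q| <= C * w j q]) -> ubound w f.
Proof.
move=> [C [C0 H]]; exists C; split=> // j q Dq.
by have [? ? ?] := H j q Dq; exists (df j q).
Qed.

End UniformBound.

Lemma ubound_union (R : realType) (J : Type) (D D1 D2 : J -> R -> Prop)
    (w f : J -> R -> R) : (forall j q, D j q -> 0 <= w j q) ->
  (forall j q, D j q -> D1 j q \/ D2 j q) ->
  ubound D1 w f -> ubound D2 w f -> ubound D w f.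
Proof.
move=> w0 DD [C [C0 H]] [C' [C0' H']]; exists (C + C'); split.
  exact: addr_ge0.
move=> j q Dq; have [/H|/H'] := DD _ _ Dq; apply: sbound_le.
  by rewrite ler_wpM2r ?w0 // lerDl.
by rewrite ler_wpM2r ?w0 // lerDr.
Qed.

(** * The correction to a sum of two bubbles *)

Section Correction.
Variables (R : realType) (m : R).
Hypothesis hm : 3 <= m.

Definition pexp : R := 1 + 4 / m.

(** In the variable [q] this is the quotient of a concentrated bubble by the
    standard one. *)
Definition bub (q : R) : R := q `^ (- (m / 2)).

(** The cross terms of the power of a sum, for the bubble and the constant [1]
    to which the background has been normalised. *)
Definition interaction (q : R) : R :=
  (1 + bub q) `^ pexp - 1 - bub q `^ pexp.

Let m0 : 0 < m. Proof. by move: hm; lra. Qed.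
Let mn0 : m != 0. Proof. by rewrite gt_eqF. Qed.

Lemma powRD_gt0 (q r s : R) : 0 < q -> q `^ r * q `^ s = q `^ (r + s).
Proof. by move=> q0; rewrite powRD // (gt_eqF q0) implybT. Qed.

Lemma powR_pexp (q a : R) : 0 < q -> (q `^ (a * (m / 2))) `^ pexp =
  q `^ (a * (m / 2 + 2)).
Proof.
by move=> q0; rewrite -powRrM; congr (_ `^ _); rewrite /pexp; field.
Qed.

Lemma bub_pexp (q : R) : 0 < q -> bub q `^ pexp = q `^ (- (m / 2 + 2)).
Proof. by move=> q0; have := powR_pexp (-1) q0; rewrite !mulN1r. Qed.

(** In the inner region the bubble dominates the background, in the outer one
    it is dominated by it; in the original distance the border [q = 1] is at
    [sqrt dl] from the centre. *)
Definition inner (dl q : R) := [/\ 0 < dl, dl < 1, dl <= q & q <= 1].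
Definition outer (dl q : R) := [/\ 0 < dl, dl < 1, 1 <= q & q <= dl^-1].

Lemma inner_gt0 dl q : inner dl q -> 0 < q.
Proof. by case=> d0 _ dq _; exact: lt_le_trans dq. Qed.

Lemma outer_gt0 dl q : outer dl q -> 0 < q.
Proof. by case=> _ _ q1 _; exact: lt_le_trans ltr01 q1. Qed.

Lemma inner_powR dl q r s : s <= r -> inner dl q -> q `^ r <= q `^ s.
Proof.
by move=> rs Dq; apply: ger_powR rs; rewrite (inner_gt0 Dq); case: Dq.
Qed.

Lemma outer_powR dl q r s : r <= s -> outer dl q -> q `^ r <= q `^ s.
Proof. by move=> rs [_ _ q1 _]; exact: ler_powR. Qed.

Lemma inner_powR_ge1 dl q s : s <= 0 -> inner dl q -> 1 <= q `^ s.
Proof. by move=> s0 Dq; rewrite -[leLHS](powRr0 q); exact: inner_powR Dq. Qed.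

Lemma inner_powR_le1 dl q s : 0 <= s -> inner dl q -> q `^ s <= 1.
Proof. by move=> s0 Dq; rewrite -[leRHS](powRr0 q); exact: inner_powR Dq. Qed.

Lemma outer_powR_ge1 dl q s : 0 <= s -> outer dl q -> 1 <= q `^ s.
Proof. by move=> s0 Dq; rewrite -[leLHS](powRr0 q); exact: outer_powR Dq. Qed.

Lemma outer_powR_le1 dl q s : s <= 0 -> outer dl q -> q `^ s <= 1.
Proof. by move=> s0 Dq; rewrite -[leRHS](powRr0 q); exact: outer_powR Dq. Qed.

(** With [y = 1 / bub q = q^(m / 2) <= 1] the interaction is
    [bub^p ((1 + y)^p - 1) - 1], of the order of [bub^p y = q^(- 2)]. *)
Lemma interaction_inner :
  ubound inner (fun _ q => q `^ (- 2)) (fun _ => interaction).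
Proof.
apply: (ubound_ext inner_gt0 (f := fun _ y : R => y `^ (- (m / 2 + 2)) *
   ((1 + y `^ (m / 2)) `^ pexp - 1) - 1)).
  move=> dl q y _ y0; rewrite /interaction bub_pexp //.
  have -> : 1 + bub y = bub y * (1 + y `^ (m / 2)).
    by rewrite mulrDr mulr1 /bub powRD_gt0 // addNr powRr0 addrC.
  by rewrite powRM ?powR_ge0 ?addr_ge0 ?powR_ge0 // bub_pexp //; ring.
apply: ubound_sub; last first.
  apply: (ubound_cst (c := fun=> 1) ler01) => dl q Dq.
  by rewrite normr1 mul1r; apply: inner_powR_ge1 Dq; lra.
have H1 := ubound_powR inner_gt0 (- (m / 2 + 2)).
have /(ubound_1powR pexp) H2 := ubound_powR inner_gt0 (m / 2).
have {}H2 := H2 _.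
apply: ubound_le (ubound_mul H1 (H2 _)).
  move=> dl q Dq; rewrite powRD_gt0 ?(inner_gt0 Dq) //.
  by apply: inner_powR Dq; move: hm; lra.
move=> dl q Dq; rewrite (le_trans _ (powR_ge0 _ _)) ?oppr_le0 ?invr_ge0 //=.
by apply: inner_powR_le1 Dq; move: hm; lra.
Qed.

Lemma interaction_outer :
  ubound outer (fun _ q => q `^ (- (m / 2))) (fun _ => interaction).
Proof.
apply: ubound_sub.
  apply: ubound_1powR; first exact: ubound_powR outer_gt0 _.
  move=> dl q Dq; rewrite (le_trans _ (powR_ge0 _ _)) ?oppr_le0 ?invr_ge0 //=.
  by apply: outer_powR_le1 Dq; move: hm; lra.
apply: (ubound_ext outer_gt0 (f := fun _ y : R => y `^ (- (m / 2 + 2)))).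
  by move=> dl q y _ y0; rewrite bub_pexp.
apply: ubound_le (ubound_powR outer_gt0 _) => dl q; apply: outer_powR; move: hm; lra.
Qed.

End Correction.

Section CorrectionBounds.
Variables (R : realType) (m : R).
Hypothesis hm : 3 <= m.
Implicit Types dl q x : R.
Local Notation bub := (bub m).
Local Notation G := (interaction m).
Local Notation pos := [set x : R | 0 < x]%classic.

Lemma Cline_1powR D (f : R -> R) (s : R) : open D ->
  (forall x, D x -> 0 <= f x) -> Cline D f -> Cline D (fun x => (1 + f x) `^ s).
Proof.
move=> oD f0 Cf.
apply: (Cline_comp (f := fun x => 1 + f x) oD _ _ (@Cline_powR R s)).
  by move=> x /f0 fx /=; rewrite ltr_wpDr.
exact: Coo_add oD (Coo_cst _ 1 oD) Cf.
Qed.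

Lemma Cline_interaction : Cline pos G.
Proof.
have oP := @open_gt R 0.
have Cb : Cline pos bub by exact: Cline_powR.
apply: Coo_sub => //; last first.
  by apply: (Cline_comp oP _ Cb (@Cline_powR R _)) => x x0; exact: powR_gt0.
apply: Coo_sub => //; last exact: Coo_cst.
by apply: Cline_1powR => // x _; exact: powR_ge0.
Qed.

Definition flux_rhs (q : R) := q `^ (m / 2) * G q.

Definition corr1 (F : R -> R) (q : R) :=
  - ((m + 2) * m / 4) * (q `^ (- ((m + 2) / 2)) * F q).

Lemma Cline_flux_rhs : Cline pos flux_rhs.
Proof.
apply: Coo_mul; [exact: open_gt|exact: Cline_powR|exact: Cline_interaction].
Qed.

(** [Ph] solves the flat radial equation
    [-(4 / ((m + 2) m)) (q Ph'' + ((m + 2) / 2) Ph') = G] for the squared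
    radius [q], and [F] is its flux. *)
Definition is_correction (dl : R) (F Ph : R -> R) :=
  [/\ F dl = 0, Ph 1 = 0,
    forall q, dl / 2 < q -> is_derive q 1 F (flux_rhs q) &
    forall q, dl / 2 < q -> is_derive q 1 Ph (corr1 F q)].

Lemma correction_exists (dl : R) : 0 < dl < 1 -> exists FP, is_correction dl FP.1 FP.2.
Proof.
move=> /andP[d0 d1].
have [|q q0|F [F0 dF]] := @primitive_exists R (dl / 4) dl flux_rhs.
- by lra.
- by apply: (Ck_cont (Cline_flux_rhs 0%N)) => /=; lra.
have [|q q0|Ph [P0 dP]] := @primitive_exists R (dl / 2) 1 (corr1 F).
- by lra.
- have q1 : 0 < q by lra.
  have dq : dl / 4 < q by lra.
  have d := is_derive_mul (is_derive1_powR (- ((m + 2) / 2)) q1) (dF q dq).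
  exact: is_derive_cont (is_derive_scale (- ((m + 2) * m / 4)) d).
exists (F, Ph); split; [by []|by []| |exact: dP].
by move=> q dq; apply: dF; lra.
Qed.

Variables F Ph : R -> R -> R.
Hypothesis FP : forall dl, 0 < dl < 1 -> is_correction dl (F dl) (Ph dl).

Let P dl := corr1 (F dl).

(** The derivative of [corr1 F], read off the equation for [Ph]. *)
Definition corr2 (F : R -> R) (q : R) :=
  - ((m + 2) / 2) * (corr1 F q / q) - (m + 2) * m / 4 * (G q / q).

Lemma is_derive_corr1 dl q : 0 < dl < 1 -> dl / 2 < q ->
  is_derive q 1 (P dl) (corr2 (F dl) q).
Proof.
move=> d01 dq; have [_ _ dF _] := FP d01.
have q0 : 0 < q by lra.
have d := is_derive_mul (is_derive1_powR (- ((m + 2) / 2)) q0) (dF q dq).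
have := is_derive_scale (- ((m + 2) * m / 4)) d.
rewrite powRB ?(gt_eqF q0) ?implybT // powRr1 ?(ltW q0) // /flux_rhs.
rewrite [_ * (_ `^ _ * G q)]mulrA powRD_gt0 //.
have -> : - ((m + 2) / 2) + m / 2 = -1 by field.
rewrite powR_inv1 ?(ltW q0) // => /is_derive_eq; apply.
by rewrite /corr2 /corr1; field; rewrite gt_eqF.
Qed.

(** The flux is the integral of [q^(m / 2) G], of the order of
    [q^(m / 2 - 2)], from the centre [q = dl]; it is bounded uniformly in [dl]
    because this exponent exceeds [- 1]. *)
Lemma flux_inner : exists C, 0 <= C /\ forall dl q, inner dl q ->
  `|F dl q| <= C * q `^ (m / 2 - 1).
Proof.
have [C [C0 H]] := interaction_inner hm.
have m2 : 0 < m / 2 - 1 by move: hm; lra.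
exists (C / (m / 2 - 1)); split; first by rewrite divr_ge0 // ltW.
move=> dl q Dq; have [d0 d1 dq q1] := Dq.
have [F0 _ dF _] := FP (introT andP (conj d0 d1)).
have := growth_comparison dq (f := F dl) (df := flux_rhs)
  (g := fun t => C / (m / 2 - 1) * t `^ (m / 2 - 1))
  (dg := fun t => C * t `^ (m / 2 - 2)).
rewrite F0 subr0 => E; apply: le_trans (E _ _ _) _.
- by move=> x /andP[dx _]; apply: dF; lra.
- move=> x /andP[dx xq]; have x0 : 0 < x by lra.
  have := is_derive_scale (C / (m / 2 - 1)) (is_derive1_powR (m / 2 - 1) x0).
  move=> /is_derive_eq; apply; rewrite mulrA divfK ?gt_eqF //.
  by congr (_ * _ `^ _); ring.
- move=> x /andP[dx xq].
  have Dx : inner dl x by split=> //; lra.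
  have := sbound_abs (H _ _ Dx); rewrite /flux_rhs normrM ger0_norm ?powR_ge0 //.
  move=> /(ler_wpM2l (powR_ge0 x (m / 2))) /le_trans; apply.
  by rewrite mulrCA powRD_gt0 ?(inner_gt0 Dx).
- by rewrite lerBlDr lerDl mulr_ge0 ?powR_ge0 // divr_ge0 // ltW.
Qed.

(** Beyond [q = 1] the factors [q^(m / 2)] and [G] balance, so the flux grows
    linearly. *)
Lemma flux_outer : exists C, 0 <= C /\ forall dl q, outer dl q ->
  `|F dl q| <= C * q.
Proof.
have [C1 [C10 H1]] := flux_inner.
have [C [C0 H]] := interaction_outer hm.
exists (C1 + C); split; first exact: addr_ge0.
move=> dl q Dq; have [d0 d1 q1 qd] := Dq.
have [F0 _ dF _] := FP (introT andP (conj d0 d1)).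
have F1 : `|F dl 1| <= C1.
  have := H1 dl 1; rewrite powR1 mulr1; apply; split=> //; exact: ltW.
have := growth_comparison q1 (f := F dl) (df := flux_rhs)
  (g := fun t => C * t) (dg := fun=> C).
move=> E; have {}E : `|F dl q - F dl 1| <= C * q - C * 1.
  apply: E.
  - by move=> x /andP[dx _]; apply: dF; lra.
  - move=> x _; have := is_derive_scale C (is_derive_id x (1 : R)).
    by rewrite mulr1.
  - move=> x /andP[x1 xq].
    have Dx : outer dl x by split=> //; apply: le_trans xq qd.
    have := sbound_abs (H _ _ Dx).
    rewrite /flux_rhs normrM ger0_norm ?powR_ge0 //.
    move=> /(ler_wpM2l (powR_ge0 x (m / 2))) /le_trans; apply.
    by rewrite mulrCA powRD_gt0 ?(outer_gt0 Dx) // subrr powRr0 mulr1.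
have -> : F dl q = F dl 1 + (F dl q - F dl 1) by ring.
apply: le_trans (ler_normD _ _) _; rewrite mulrDl.
have : C1 * 1 <= C1 * q by rewrite ler_wpM2l.
lra.
Qed.

Lemma corr1_inner : ubound (@inner R) (fun _ q => q `^ (- 2)) P.
Proof.
have [C [C0 H]] := flux_inner.
have [C' [C0' H']] := interaction_inner hm.
have [c cE] : exists c, (m + 2) * m / 4 = c by eexists.
have c0 : 0 <= c by rewrite -cE; move: hm; nra.
have n0 : 0 <= (m + 2) / 2 by move: hm; lra.
have K0 : 0 <= c * C by rewrite mulr_ge0.
have K0' : 0 <= c * C' by rewrite mulr_ge0.
have P0 dl q : inner dl q -> `|P dl q| <= c * C * q `^ (- 2).
  move=> Dq; rewrite /P /corr1 cE mulNr normrN normrM ger0_norm // -[leRHS]mulrA.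
  rewrite ler_wpM2l // normrM ger0_norm ?powR_ge0 //.
  apply: le_trans (ler_wpM2l (powR_ge0 _ _) (H _ _ Dq)) _.
  rewrite mulrCA powRD_gt0 ?(inner_gt0 Dq) // ler_wpM2l //.
  by rewrite le_eqVlt; apply/orP; left; apply/eqP; congr (_ `^ _); field.
apply: (ubound_derive (df := fun dl => corr2 (F dl))).
exists (c * C + ((m + 2) / 2 * (c * C) + c * C')); split.
  by apply: addr_ge0 => //; apply: addr_ge0 => //; exact: mulr_ge0.
move=> dl q Dq; have [d0 d1 dq q1] := Dq; have q0 := inner_gt0 Dq; split.
- by apply: is_derive_corr1; [rewrite d0 d1|lra].
- apply: le_trans (P0 _ _ Dq) _; rewrite ler_wpM2r ?powR_ge0 // lerDl.
  by apply: addr_ge0 => //; exact: mulr_ge0.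
- have -> : q * corr2 (F dl) q =
     - ((m + 2) / 2 * P dl q) - c * G q.
    by rewrite /corr2 /P -cE; field; rewrite gt_eqF.
  apply: le_trans (ler_normB _ _) _; rewrite normrN (mulrDl (c * C)) (mulrDl (_ * (c * C))).
  have A1 : `|(m + 2) / 2 * P dl q| <= (m + 2) / 2 * (c * C) * q `^ (- 2).
    by rewrite normrM ger0_norm // -[leRHS]mulrA ler_wpM2l // P0.
  have A2 : `|c * G q| <= c * C' * q `^ (- 2).
    rewrite normrM ger0_norm // -[leRHS]mulrA ler_wpM2l //.
    exact: sbound_abs (H' _ _ Dq).
  apply: ler_wpDl; first by rewrite mulr_ge0 ?powR_ge0.
  exact: lerD A1 A2.
Qed.

Lemma corr1_outer : ubound (@outer R) (fun _ q => q `^ (- (3 / 2))) P.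
Proof.
have [C [C0 H]] := flux_outer.
have [C' [C0' H']] := interaction_outer hm.
have [c cE] : exists c, (m + 2) * m / 4 = c by eexists.
have c0 : 0 <= c by rewrite -cE; move: hm; nra.
have n0 : 0 <= (m + 2) / 2 by move: hm; lra.
have K0 : 0 <= c * C by rewrite mulr_ge0.
have K0' : 0 <= c * C' by rewrite mulr_ge0.
have P0 dl q : outer dl q -> `|P dl q| <= c * C * q `^ (- (3 / 2)).
  move=> Dq; have q0 := outer_gt0 Dq.
  rewrite /P /corr1 cE mulNr normrN normrM ger0_norm // -[leRHS]mulrA.
  rewrite ler_wpM2l // normrM ger0_norm ?powR_ge0 //.
  apply: le_trans (ler_wpM2l (powR_ge0 _ _) (H _ _ Dq)) _.
  rewrite mulrCA -[X in _ * (_ * X)](powRr1 (ltW q0)) powRD_gt0 // ler_wpM2l //.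
  by apply: outer_powR Dq; move: hm; lra.
apply: (ubound_derive (df := fun dl => corr2 (F dl))).
exists (c * C + ((m + 2) / 2 * (c * C) + c * C')); split.
  by apply: addr_ge0 => //; apply: addr_ge0 => //; exact: mulr_ge0.
move=> dl q Dq; have [d0 d1 q1 qd] := Dq; have q0 := outer_gt0 Dq; split.
- by apply: is_derive_corr1; [rewrite d0 d1|lra].
- apply: le_trans (P0 _ _ Dq) _; rewrite ler_wpM2r ?powR_ge0 // lerDl.
  by apply: addr_ge0 => //; exact: mulr_ge0.
- have -> : q * corr2 (F dl) q =
     - ((m + 2) / 2 * P dl q) - c * G q.
    by rewrite /corr2 /P -cE; field; rewrite gt_eqF.
  apply: le_trans (ler_normB _ _) _; rewrite normrN (mulrDl (c * C)) (mulrDl (_ * (c * C))).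
  have A1 : `|(m + 2) / 2 * P dl q| <= (m + 2) / 2 * (c * C) * q `^ (- (3 / 2)).
    by rewrite normrM ger0_norm // -[leRHS]mulrA ler_wpM2l // P0.
  have A2 : `|c * G q| <= c * C' * q `^ (- (3 / 2)).
    rewrite normrM ger0_norm // -[leRHS]mulrA ler_wpM2l //.
    apply: le_trans (sbound_abs (H' _ _ Dq)) _; rewrite ler_wpM2l //.
    by apply: outer_powR Dq; move: hm; lra.
  apply: ler_wpDl; first by rewrite mulr_ge0 ?powR_ge0.
  exact: lerD A1 A2.
Qed.

Lemma corr_inner : ubound (@inner R) (fun _ q => q `^ (- 1)) Ph.
Proof.
have [C [C0 H]] := corr1_inner.
apply: (ubound_derive (df := P)); exists C; split=> // dl q Dq.
have [d0 d1 dq q1] := Dq; have q0 := inner_gt0 Dq.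
have [_ P1 _ dP] := FP (introT andP (conj d0 d1)).
split; first by apply: dP; lra.
- have := growth_comparison q1 (f := Ph dl) (df := P dl)
    (g := fun t => (- C) * t `^ (- 1)) (dg := fun t => C * t `^ (- 2)).
  rewrite P1 sub0r normrN powR1 => E; apply: le_trans (E _ _ _) _.
  + by move=> x /andP[dx _]; apply: dP; lra.
  + move=> x /andP[dx xq]; have x0 : 0 < x by lra.
    have := is_derive_scale (- C) (is_derive1_powR (- 1) x0).
    move=> /is_derive_eq; apply; rewrite mulrA mulrNN mulr1.
    by congr (_ * _ `^ _); ring.
  + move=> x /andP[qx x1]; apply: (sbound_abs (H _ _ _)).
    by split=> //; apply: le_trans qx.
  + by lra.
- rewrite normrM gtr0_norm //.
  apply: le_trans (ler_wpM2l (ltW q0) (sbound_abs (H _ _ Dq))) _.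
  rewrite mulrCA -[X in X * (_ `^ _)](powRr1 (ltW q0)) powRD_gt0 // ler_wpM2l //.
  by rewrite le_eqVlt; apply/orP; left; apply/eqP; congr (_ `^ _); ring.
Qed.

(** Bounded because [q^(- 3 / 2)] is integrable at infinity. *)
Lemma corr_outer : ubound (@outer R) (fun _ _ => 1) Ph.
Proof.
have [C [C0 H]] := corr1_outer.
apply: (ubound_derive (df := P)); exists (2 * C); split.
  exact: mulr_ge0.
move=> dl q Dq; have [d0 d1 q1 qd] := Dq; have q0 := outer_gt0 Dq.
have [_ P1 _ dP] := FP (introT andP (conj d0 d1)).
rewrite mulr1; split; first by apply: dP; lra.
- have := growth_comparison q1 (f := Ph dl) (df := P dl)
    (g := fun t => (- 2 * C) * t `^ (- (1 / 2))) (dg := fun t => C * t `^ (- (3 / 2))).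
  rewrite P1 subr0 powR1 => E; apply: le_trans (E _ _ _) _.
  + by move=> x /andP[dx _]; apply: dP; lra.
  + move=> x /andP[dx xq]; have x0 : 0 < x by lra.
    have := is_derive_scale (- 2 * C) (is_derive1_powR (- (1 / 2)) x0).
    move=> /is_derive_eq; apply; rewrite mulrA.
    by congr (_ * _ `^ _); field.
  + move=> x /andP[x1 xq]; apply: (sbound_abs (H _ _ _)).
    by split=> //; apply: le_trans xq qd.
  + have := mulr_ge0 C0 (powR_ge0 q (- (1 / 2))); lra.
- rewrite normrM gtr0_norm //.
  apply: le_trans (ler_wpM2l (ltW q0) (sbound_abs (H _ _ Dq))) _.
  rewrite mulrCA -[X in X * (_ `^ _)](powRr1 (ltW q0)) powRD_gt0 //.
  rewrite mulrC ler_wpM2r //; apply: le_trans (outer_powR_le1 _ Dq) _; last by lra.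
  by lra.
Qed.

End CorrectionBounds.

Section RelativeError.
Variables (R : realType) (m : R).
Hypothesis hm : 3 <= m.
Implicit Types dl q x y : R.
Local Notation bub := (bub m).
Local Notation G := (interaction m).
Local Notation pexp := (pexp m).
Variables F Ph : R -> R -> R.
Hypothesis FP : forall dl, 0 < dl < 1 -> is_correction m dl (F dl) (Ph dl).
Local Notation P dl := (corr1 m (F dl)).

Definition concentrated dl q := [/\ 0 < dl, dl < 1, dl <= q & q <= dl^-1].

Lemma concentrated_gt0 dl q : concentrated dl q -> 0 < q.
Proof. by case=> d0 _ dq _; exact: lt_le_trans dq. Qed.

Lemma concentratedP dl q : concentrated dl q -> inner dl q \/ outer dl q.
Proof.
case=> d0 d1 dq qd; have [q1|q1] := leP q 1; [left|right]; split=> //.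
exact: ltW.
Qed.

(** [dl * err dl] is the defect left when [1 + bub + dl * Ph] is inserted in
    the conformal Laplacian in place of an exact solution. *)
Definition err dl q :=
  Ph dl q - (q `^ (- 1) + q - dl) * G q - 2 / m * ((q `^ (- 1) - q) * P dl q).

Lemma err_inner : ubound (@inner R) (fun _ q => q `^ (- 3)) err.
Proof.
have Hq : ubound (@inner R) (fun _ q => q `^ (- 1)) (fun _ q => q).
  exists 1; split=> // dl q Dq; have q0 := inner_gt0 Dq.
  apply: sbound_le (sbound_id q0); rewrite mul1r -[leLHS](powRr1 (ltW q0)).
  by apply: inner_powR Dq; lra.
have Hi := ubound_powR (@inner_gt0 R) (- 1).
have Hd : ubound (@inner R) (fun _ q => q `^ (- 1)) (fun dl _ => dl).
  apply: (ubound_cst (C := 1)) => // dl q Dq; have [d0 d1 _ _] := Dq.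
  rewrite gtr0_norm // mul1r; apply: le_trans (ltW d1) _.
  by apply: inner_powR_ge1 Dq; lra.
apply: ubound_sub; first apply: ubound_sub.
- apply: ubound_le (corr_inner hm FP) => dl q Dq.
  by apply: inner_powR Dq; lra.
- apply: ubound_le (ubound_mul (ubound_sub (ubound_add Hi Hq) Hd)
    (interaction_inner hm)) => dl q Dq.
  by rewrite powRD_gt0 ?(inner_gt0 Dq) //; apply: inner_powR Dq; lra.
- apply: ubound_scale.
  apply: ubound_le (ubound_mul (ubound_sub Hi Hq) (corr1_inner hm FP)) => dl q Dq.
  by rewrite powRD_gt0 ?(inner_gt0 Dq) //; apply: inner_powR Dq; lra.
Qed.

Lemma err_outer : ubound (@outer R) (fun _ _ => 1) err.
Proof.
have Hq : ubound (@outer R) (fun _ q => q `^ 1) (fun _ q => q).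
  exists 1; split=> // dl q Dq; have q0 := outer_gt0 Dq.
  by apply: sbound_le (sbound_id q0); rewrite mul1r powRr1 // ltW.
have Hi : ubound (@outer R) (fun _ q => q `^ 1) (fun _ q => q `^ (- 1)).
  apply: ubound_le (ubound_powR (@outer_gt0 R) (- 1)) => dl q Dq.
  by apply: outer_powR Dq; lra.
have Hd : ubound (@outer R) (fun _ q => q `^ 1) (fun dl _ => dl).
  apply: (ubound_cst (C := 1)) => // dl q Dq; have [d0 d1 _ _] := Dq.
  rewrite gtr0_norm // mul1r; apply: le_trans (ltW d1) _.
  by apply: outer_powR_ge1 Dq; lra.
apply: ubound_sub; first apply: ubound_sub.
- exact: (corr_outer hm FP).
- apply: ubound_le (ubound_mul (ubound_sub (ubound_add Hi Hq) Hd)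
    (interaction_outer hm)) => dl q Dq.
  rewrite powRD_gt0 ?(outer_gt0 Dq) //; apply: outer_powR_le1 Dq.
  by move: hm; lra.
- apply: ubound_scale.
  apply: ubound_le (ubound_mul (ubound_sub Hi Hq) (corr1_outer hm FP)) => dl q Dq.
  rewrite powRD_gt0 ?(outer_gt0 Dq) //; apply: outer_powR_le1 Dq.
  by lra.
Qed.

Lemma sum_powR_inner (s : R) : ubound (@inner R)
  (fun _ q => q `^ (- (m / 2) * s)) (fun _ q => (1 + bub q) `^ s).
Proof.
apply: (ubound_ext (@inner_gt0 R) (f := fun _ y =>
   y `^ (- (m / 2) * s) * (((1 + y `^ (m / 2)) `^ s - 1) + 1))).
  move=> dl q y _ y0.
  have -> : 1 + bub y = bub y * (1 + y `^ (m / 2)).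
    by rewrite mulrDr mulr1 /bub powRD_gt0 // addNr powRr0 addrC.
  by rewrite powRM ?powR_ge0 ?addr_ge0 ?powR_ge0 // (powRrM y (- (m / 2)) s) subrK.
have H1 : ubound (@inner R) (fun _ _ => 1) (fun _ q => q `^ (m / 2)).
  apply: ubound_le (ubound_powR (@inner_gt0 R) _) => dl q Dq.
  by apply: inner_powR_le1 Dq; move: hm; lra.
have H2 := ubound_1powR s H1 _.
apply: ubound_le (ubound_mul (ubound_powR (@inner_gt0 R) _)
   (ubound_add (H2 _) (ubound_cst ler01 _))).
- by move=> dl q Dq; rewrite mulr1.
- move=> dl q Dq; rewrite (le_trans _ (powR_ge0 _ _)) ?oppr_le0 ?invr_ge0 //=.
  by apply: inner_powR_le1 Dq; move: hm; lra.
- by move=> dl q Dq; rewrite normr1 mulr1.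
Qed.

Lemma bub_outer : ubound (@outer R) (fun _ q => q `^ (- 1)) (fun _ => bub).
Proof.
apply: ubound_le (ubound_powR (@outer_gt0 R) _) => dl q Dq.
by apply: outer_powR Dq; move: hm; lra.
Qed.

Lemma bub_outer_itv dl q : outer dl q -> - 2^-1 <= bub q <= 1.
Proof.
move=> Dq; rewrite (le_trans _ (powR_ge0 _ _)) ?oppr_le0 ?invr_ge0 //=.
by apply: outer_powR_le1 Dq; move: hm; lra.
Qed.

Lemma sum_powR_outer (s : R) : ubound (@outer R)
  (fun _ q => q `^ (- 1)) (fun _ q => (1 + bub q) `^ s - 1).
Proof. by apply: ubound_1powR => [|dl q]; [exact: bub_outer|exact: bub_outer_itv]. Qed.

Lemma sum_powR_outer1 (s : R) : ubound (@outer R)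
  (fun _ _ => 1) (fun _ q => (1 + bub q) `^ s).
Proof.
apply: (ubound_ext (@outer_gt0 R) (f := fun _ y => ((1 + bub y) `^ s - 1) + 1)).
  by move=> dl q y _ _; rewrite subrK.
apply: ubound_add; last by apply: (ubound_cst ler01) => dl q _; rewrite normr1 mulr1.
apply: ubound_le (sum_powR_outer s) => dl q Dq; apply: outer_powR_le1 Dq.
by lra.
Qed.

(** The factor [(1 + bub)^s] with [s < 0] gains [q^(- m s / 2)] at the centre.
    The gain of [q^(1 / 2)] is what turns the size [dl] of the defect into the
    Lipschitz constant [sqrt dl] there. *)
Lemma relative_bound (f : R -> R -> R) (s t : R) :
  t - m / 2 * s >= 1 / 2 ->
  ubound (@inner R) (fun _ q => q `^ t) f -> ubound (@outer R) (fun _ _ => 1) f ->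
  ubound concentrated (fun _ q => q `^ (1 / 2))
    (fun dl y => f dl y * (1 + bub y) `^ s).
Proof.
move=> st fi fo.
apply: (ubound_union (D1 := @inner R) (D2 := @outer R)).
- by move=> dl q _; exact: powR_ge0.
- exact: concentratedP.
- apply: ubound_le (ubound_mul fi (sum_powR_inner s)) => dl q Dq.
  by rewrite powRD_gt0 ?(inner_gt0 Dq) //; apply: inner_powR Dq; lra.
- apply: ubound_le (ubound_mul fo (sum_powR_outer1 s)) => dl q Dq.
  by rewrite mulr1; apply: outer_powR_ge1 Dq; lra.
Qed.

Lemma relative_err : ubound concentrated (fun _ q => q `^ (1 / 2))
  (fun dl y => err dl y * (1 + bub y) `^ (- pexp)).
Proof.
apply: relative_bound err_inner err_outer.
have -> : m / 2 * - pexp = - (m / 2) - 2.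
  by rewrite /pexp; field; move: hm => /(lt_le_trans _) H; rewrite gt_eqF ?H.
by move: hm; lra.
Qed.

Lemma relative_corr : ubound concentrated (fun _ q => q `^ (1 / 2))
  (fun dl y => Ph dl y * (1 + bub y) `^ (- 1)).
Proof.
apply: relative_bound (corr_inner hm FP) (corr_outer hm FP).
by move: hm; lra.
Qed.

End RelativeError.

(** * The radial profile *)

Section Profile.
Variables (R : realType) (m : R).
Hypothesis hm : 3 <= m.
Implicit Types dl q x y : R.
Local Notation bub := (bub m).
Local Notation G := (interaction m).
Local Notation pexp := (pexp m).

(** On functions of [q] this is the conformal Laplacian of the unit sphere of
    dimension [m + 2], normalised to fix the constants. *)
Definition confL dl (h h1 h2 : R -> R) q :=
  h q - 4 / ((m + 2) * m) * ((q - dl) * (dl^-1 - q) * h2 q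
        + (m + 2) / 2 * (dl + dl^-1 - 2 * q) * h1 q).

Definition bub1 q := - (m / 2) * (bub q / q).
Definition bub2 q := m / 2 * (m / 2 + 1) * (bub q / q ^+ 2).

Lemma is_derive_bub q : 0 < q -> is_derive q 1 bub (bub1 q).
Proof.
move=> q0; have := is_derive1_powR (- (m / 2)) q0.
move=> /is_derive_eq; apply; rewrite powRB ?(gt_eqF q0) ?implybT //.
by rewrite powRr1 // ltW.
Qed.

Lemma is_derive_bub1 q : 0 < q -> is_derive q 1 bub1 (bub2 q).
Proof.
move=> q0; have q0' : q != 0 by rewrite gt_eqF.
have d := is_derive_mul (is_derive_bub q0)
            (is_derive_inv q0' (is_derive_id q (1 : R))).
have := is_derive_scale (- (m / 2)) d.
by move=> /is_derive_eq; apply; rewrite /bub1 /bub2; field.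
Qed.

Section FixedCorrection.
Variables (F Ph : R -> R -> R).
Hypothesis FP : forall dl, 0 < dl < 1 -> is_correction m dl (F dl) (Ph dl).
Local Notation P dl := (corr1 m (F dl)).
Local Notation err := (err m F Ph).

Definition pert dl q := bub q + dl * Ph dl q.
Definition pert1 dl q := bub1 q + dl * P dl q.
Definition pert2 dl q := bub2 q + dl * corr2 m (F dl) q.

Lemma is_derive_pert dl q : 0 < dl < 1 -> dl / 2 < q ->
  is_derive q 1 (pert dl) (pert1 dl q).
Proof.
move=> d01 dq; have [_ _ _ dP] := FP d01.
have q0 : 0 < q by lra.
exact: is_derive_add (is_derive_bub q0) (is_derive_scale dl (dP q dq)).
Qed.

Lemma is_derive_pert1 dl q : 0 < dl < 1 -> dl / 2 < q ->
  is_derive q 1 (pert1 dl) (pert2 dl q).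
Proof.
move=> d01 dq; have q0 : 0 < q by lra.
exact: is_derive_add (is_derive_bub1 q0)
  (is_derive_scale dl (is_derive_corr1 FP d01 dq)).
Qed.

(** The operator maps [bub] to [bub^p] exactly, and [Ph] cancels the interaction
    at leading order; [1] is left out of [pert], whence the [- 1]. *)
Lemma confL_pert dl q : 0 < dl -> 0 < q ->
  confL dl (pert dl) (pert1 dl) (pert2 dl) q =
  (1 + bub q) `^ pexp - 1 + dl * err dl q.
Proof.
move=> d0 q0; have mn0 : m != 0 by rewrite gt_eqF // (lt_le_trans _ hm).
have m2n0 : m + 2 != 0 by rewrite gt_eqF //; move: hm; lra.
have GE : (1 + bub q) `^ pexp = G q + 1 + bub q / q ^+ 2.
  rewrite /interaction; suff -> : bub q `^ pexp = bub q / q ^+ 2 by ring.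
  rewrite bub_pexp // opprD -powRD_gt0 // /bub; congr (_ * _).
  by rewrite powRN -powR_mulrn ?(ltW q0).
rewrite /confL /err GE /pert /pert1 /pert2 /corr2 /bub1 /bub2.
rewrite powR_inv1 ?(ltW q0) //.
by field; rewrite mn0 m2n0 !gt_eqF.
Qed.

(* [X] is a cutoff on the scale of the original distance, fixed while [dl]
    tends to [0]; in the variable [q] it acts as [X (dl * q)]. *)
Variables (X X1 X2 X3 : R -> R) (CX w1 w2 : R).
Hypothesis dX : forall x, is_derive x 1 X (X1 x).
Hypothesis dX1 : forall x, is_derive x 1 X1 (X2 x).
Hypothesis dX2 : forall x, is_derive x 1 X2 (X3 x).
Hypothesis CX0 : 0 <= CX.
Hypothesis XB : forall x, 0 <= x <= 1 ->
  [/\ `|X x| <= CX, `|X1 x| <= CX, `|X2 x| <= CX & `|X3 x| <= CX].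
Hypothesis w1_gt0 : 0 < w1.
Hypothesis X_1 : forall x, x < w1 -> [/\ X x = 1, X1 x = 0 & X2 x = 0].
Hypothesis X_0 : forall x, w2 < x -> [/\ X x = 0, X1 x = 0 & X2 x = 0].

Definition eta dl q := 1 + X (dl * q) * pert dl q.
Definition eta1 dl q := dl * (X1 (dl * q) * pert dl q) + X (dl * q) * pert1 dl q.
Definition eta2 dl q := dl ^+ 2 * (X2 (dl * q) * pert dl q)
  + 2 * dl * (X1 (dl * q) * pert1 dl q) + X (dl * q) * pert2 dl q.
Definition curv dl q :=
  confL dl (eta dl) (eta1 dl) (eta2 dl) q * eta dl q `^ (- pexp).

Lemma is_derive_dilate (f : R -> R) (df dl q : R) :
  is_derive (dl * q) 1 f df -> is_derive q 1 (fun y => f (dl * y)) (dl * df).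
Proof.
move=> d; have := is_derive_comp (is_derive_scale dl (is_derive_id q (1 : R))) d.
by rewrite mulr1 mulrC.
Qed.

Lemma is_derive_eta dl q : 0 < dl < 1 -> dl / 2 < q ->
  is_derive q 1 (eta dl) (eta1 dl q).
Proof.
move=> d01 dq.
have d := is_derive_mul (is_derive_dilate (dX (dl * q))) (is_derive_pert d01 dq).
have := is_derive_add (is_derive_cstE (1 : R) q (1 : R)) d.
by rewrite add0r /eta1 mulrA.
Qed.

Lemma is_derive_eta1 dl q : 0 < dl < 1 -> dl / 2 < q ->
  is_derive q 1 (eta1 dl) (eta2 dl q).
Proof.
move=> d01 dq.
have dp := is_derive_pert d01 dq; have dp1 := is_derive_pert1 d01 dq.
have d := is_derive_add
  (is_derive_scale dl (is_derive_mul (is_derive_dilate (dX1 (dl * q))) dp))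
  (is_derive_mul (is_derive_dilate (dX (dl * q))) dp1).
by move: d => /is_derive_eq; apply; rewrite /eta2; ring.
Qed.

Lemma eta_far dl q : w2 < dl * q -> eta dl q = 1 /\ curv dl q = 1.
Proof.
move=> wq; have [E0 E1 E2] := X_0 wq.
have e1 : eta dl q = 1 by rewrite /eta E0 mul0r addr0.
by split=> //; rewrite /curv /confL e1 /eta1 /eta2 E0 E1 E2 powR1; ring.
Qed.

(** Away from the centre, where the cutoff acts, the bubble and its correction
    are each of size [dl], so that no cancellation is needed. *)
Definition far dl q := outer dl q /\ w1 <= dl * q.

Lemma far_gt0 dl q : far dl q -> 0 < q.
Proof. by case=> /outer_gt0. Qed.

Lemma far_outer w (f : R -> R -> R) : ubound (@outer R) w f -> ubound far w f.
Proof. by move=> [C [C0 H]]; exists C; split=> // dl q [/H]. Qed.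

Lemma far_inv (f : R -> R -> R) : ubound (@outer R) (fun _ q => q `^ (- 1)) f ->
  ubound far (fun dl _ => dl) f.
Proof.
move=> [C [C0 H]]; exists (C / w1); split; first by rewrite divr_ge0 // ltW.
move=> dl q Dq; have q0 := far_gt0 Dq; case: Dq => Dq wq.
apply: sbound_le (H _ _ Dq); rewrite -mulrA ler_wpM2l //.
by rewrite powR_inv1 ?(ltW q0) // ler_pdivlMl // -(@ler_pM2r _ q) // -mulrA mulVf ?gt_eqF // mulr1.
Qed.

Lemma far_dl : ubound far (fun dl _ => dl) (fun dl _ => dl).
Proof.
by apply: (ubound_cst ler01) => dl q [[d0 _ _ _] _]; rewrite gtr0_norm ?mul1r.
Qed.

Lemma far_one (c : R) : ubound far (fun _ _ => 1) (fun _ _ => c).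
Proof. by apply: (ubound_cst (normr_ge0 c)) => dl q _; rewrite mulr1. Qed.

Lemma far_dlq : ubound far (fun _ _ => 1) (fun dl y => dl * y).
Proof.
exists 1; split=> // dl q Dq; have q0 := far_gt0 Dq.
case: Dq => [[d0 d1 q1 qd] _].
have := sbound_scale dl (sbound_id q0); apply: sbound_le.
rewrite gtr0_norm // !mul1r; apply: le_trans (ler_wpM2l (ltW d0) qd) _.
by rewrite divff // gt_eqF.
Qed.

Lemma far_dilate (f df : R -> R) : (forall x, is_derive x 1 f (df x)) ->
  (forall x, 0 <= x <= 1 -> `|f x| <= CX /\ `|df x| <= CX) ->
  ubound far (fun _ _ => 1) (fun dl y => f (dl * y)).
Proof.
move=> Df B; apply: (ubound_derive (df := fun dl q => dl * df (dl * q))).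
exists CX; split=> // dl q Dq; have q0 := far_gt0 Dq.
case: Dq => [[d0 d1 q1 qd] _].
have dq0 : 0 <= dl * q by rewrite mulr_ge0 // ltW.
have dq1 : dl * q <= 1.
  by apply: le_trans (ler_wpM2l (ltW d0) qd) _; rewrite divff // gt_eqF.
have [B1 B2] := B (dl * q) (introT andP (conj dq0 dq1)).
rewrite mulr1; split=> //; first exact: is_derive_dilate.
rewrite mulrA [q * dl]mulrC normrM (ger0_norm dq0).
by apply: le_trans B2; rewrite ler_piMl.
Qed.

Let far_mul w w' w'' (f g : R -> R -> R) :
  (forall dl q, far dl q -> w dl q * w' dl q <= w'' dl q) ->
  ubound far w f -> ubound far w' g ->
  ubound far w'' (fun dl y => f dl y * g dl y).
Proof. by move=> ww hf hg; apply: ubound_le ww _; exact: ubound_mul. Qed.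

Let far_mul11 (f g : R -> R -> R) : ubound far (fun _ _ => 1) f ->
  ubound far (fun _ _ => 1) g ->
  ubound far (fun _ _ => 1) (fun dl y => f dl y * g dl y).
Proof. by apply: far_mul => dl q _; rewrite mulr1. Qed.

Let far_mul1d (f g : R -> R -> R) : ubound far (fun _ _ => 1) f ->
  ubound far (fun dl _ => dl) g ->
  ubound far (fun dl _ => dl) (fun dl y => f dl y * g dl y).
Proof. by apply: far_mul => dl q _; rewrite mul1r. Qed.

Let far_muld1 (f g : R -> R -> R) : ubound far (fun dl _ => dl) f ->
  ubound far (fun _ _ => 1) g ->
  ubound far (fun dl _ => dl) (fun dl y => f dl y * g dl y).
Proof. by apply: far_mul => dl q _; rewrite mulr1. Qed.

Lemma far_pert : ubound far (fun dl _ => dl) pert.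
Proof.
apply: ubound_add; first exact: far_inv (bub_outer hm).
exact: far_muld1 far_dl (far_outer (corr_outer hm FP)).
Qed.

Lemma far_pert1 : ubound far (fun dl _ => dl) (fun dl y => y * pert1 dl y).
Proof.
apply: (ubound_ext far_gt0
  (f := fun dl y => - (m / 2) * bub y + dl * (y `^ 1 * P dl y))).
  move=> dl q y _ y0; rewrite /pert1 /bub1 powRr1 ?(ltW y0) //.
  by field; rewrite gt_eqF.
apply: ubound_add.
  exact: ubound_scale (far_inv (bub_outer hm)).
apply: far_muld1 far_dl _; apply: far_outer.
apply: ubound_le (ubound_mul (ubound_powR (@outer_gt0 R) _)
  (corr1_outer hm FP)) => dl q Dq.
by rewrite powRD_gt0 ?(outer_gt0 Dq) //; apply: outer_powR_le1 Dq; lra.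
Qed.

(** All the terms with a derivative of the cutoff are written with factors
    that stay bounded: [dl * y] is the scale of the cutoff and [y * pert1] is
    the derivative of [pert] with respect to [ln y]. *)
Definition far_defect dl y :=
  X (dl * y) * ((1 + bub y) `^ pexp - 1 + dl * err dl y)
  - 4 / ((m + 2) * m) *
    ((dl * y - dl * dl) * (1 - dl * y) * (X2 (dl * y) * pert dl y)
    + 2 * ((1 - dl * y `^ (- 1)) * (1 - dl * y) * (X1 (dl * y) * (y * pert1 dl y)))
    + (m + 2) / 2 * ((1 + dl * dl - 2 * (dl * y)) * (X1 (dl * y) * pert dl y))).

Lemma confL_eta dl y : 0 < dl -> 0 < y ->
  confL dl (eta dl) (eta1 dl) (eta2 dl) y = 1 + far_defect dl y.
Proof.
move=> d0 y0; rewrite /far_defect -confL_pert // powR_inv1 ?(ltW y0) //.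
rewrite /confL /eta /eta1 /eta2.
have mn0 : m != 0 by rewrite gt_eqF // (lt_le_trans _ hm).
have m2n0 : m + 2 != 0 by rewrite gt_eqF //; move: hm; lra.
by field; rewrite mn0 m2n0 !gt_eqF.
Qed.

Lemma far_defect_bound : ubound far (fun dl _ => dl) far_defect.
Proof.
have BX : ubound far (fun _ _ => 1) (fun dl y => X (dl * y)).
  by apply: far_dilate dX _ => x /XB [].
have BX1 : ubound far (fun _ _ => 1) (fun dl y => X1 (dl * y)).
  by apply: far_dilate dX1 _ => x /XB [].
have BX2 : ubound far (fun _ _ => 1) (fun dl y => X2 (dl * y)).
  by apply: far_dilate dX2 _ => x /XB [].
have Bd : ubound far (fun _ _ => 1) (fun dl _ => dl).
  by apply: ubound_le far_dl => dl q [[_ d1 _ _] _]; exact: ltW.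
have Bdd := far_mul11 Bd Bd.
have Bi : ubound far (fun _ _ => 1) (fun _ y => y `^ (- 1)).
  apply: far_outer; apply: ubound_le (ubound_powR (@outer_gt0 R) _) => dl q Dq.
  by apply: outer_powR_le1 Dq; lra.
apply: ubound_sub.
  apply: far_mul1d BX _; apply: ubound_add.
    exact: far_inv (sum_powR_outer hm pexp).
  exact: far_muld1 far_dl (far_outer (err_outer hm FP)).
have B1 := ubound_sub (far_one 1) far_dlq.
apply: ubound_scale; apply: ubound_add; first apply: ubound_add.
- apply: far_mul1d; first exact: far_mul11 (ubound_sub far_dlq Bdd) B1.
  exact: far_mul1d BX2 far_pert.
- apply: ubound_scale; apply: far_mul1d.
    exact: far_mul11 (ubound_sub (far_one 1) (far_mul11 Bd Bi)) B1.
  exact: far_mul1d BX1 far_pert1.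
- apply: ubound_scale; apply: far_mul1d; last exact: far_mul1d BX1 far_pert.
  exact: ubound_sub (ubound_add (far_one 1) Bdd) (ubound_scale 2 far_dlq).
Qed.

Lemma far_eta_bound : ubound far (fun dl _ => dl)
  (fun dl y => X (dl * y) * pert dl y).
Proof.
apply: far_mul1d; last exact: far_pert.
by apply: far_dilate dX _ => x /XB [].
Qed.

Lemma pert_factor dl y : 1 + pert dl y =
  (1 + bub y) * (1 + dl * (Ph dl y * (1 + bub y) `^ (- 1))).
Proof.
have S0 : 0 < 1 + bub y by rewrite ltr_wpDr // powR_ge0.
by rewrite /pert powR_inv1 ?(ltW S0) //; field; rewrite gt_eqF.
Qed.

(** Dividing numerator and denominator by [(1 + bub)^p] leaves only relative
    errors. *)
Lemma curv_central dl y : 0 < dl -> 0 < y -> dl * y < w1 ->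
  0 <= 1 + dl * (Ph dl y * (1 + bub y) `^ (- 1)) ->
  curv dl y = (1 + dl * (err dl y * (1 + bub y) `^ (- pexp))) *
              (1 + dl * (Ph dl y * (1 + bub y) `^ (- 1))) `^ (- pexp).
Proof.
move=> d0 y0 yw b0; have [E0 E1 E2] := X_1 yw.
have S0 : 0 < 1 + bub y by rewrite ltr_wpDr // powR_ge0.
rewrite /curv confL_eta // /far_defect E0 E1 E2 /eta E0 [1 * pert _ _]mul1r.
rewrite pert_factor.
rewrite powRM ?(ltW S0) // mulrA; congr (_ * _).
have m00 : 0 < m by exact: lt_le_trans hm.
have m20 : 0 < m + 2 by move: hm; lra.
by rewrite powRN; field; rewrite (gt_eqF (powR_gt0 _ S0)) !gt_eqF.
Qed.

(** [C] may depend on the cutoff: it is multiplied by [dl q^(1 / 2)], at most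
    [dl^(1 / 2)], which is chosen after the cutoff. *)
Lemma curv_bound : exists C, 0 <= C /\ forall dl q, concentrated dl q ->
  dl < w1 -> C * (dl * q `^ (1 / 2)) <= 2^-1 -> 0 < eta dl q /\
  sbound q ((1 + 3 * pow_const (- pexp)) * (C * (dl * q `^ (1 / 2))))
    (fun y => curv dl y - 1).
Proof.
have [C1 [C10 H1]] := relative_err hm FP.
have [C2 [C20 H2]] := relative_corr hm FP.
have [C3 [C30 H3]] := far_defect_bound.
have [C4 [C40 H4]] := far_eta_bound.
exists (C1 + C2 + C3 + C4); split; first by rewrite !addr_ge0.
move=> dl q Dq dw; have q0 := concentrated_gt0 Dq; have [d0 d1 dq qd] := Dq.
have t0 : 0 <= dl * q `^ (1 / 2) by rewrite mulr_ge0 ?powR_ge0 // ltW.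
set t := dl * _ in t0 *; set a := _ * t => a2.
have [qw|wq] := ltP (dl * q) w1.
- have f1 : sbound q a (fun y => dl * (err dl y * (1 + bub y) `^ (- pexp))).
    apply: sbound_le (sbound_scale dl (H1 _ _ Dq)).
    by rewrite gtr0_norm // mulrCA ler_wpM2r //; lra.
  have f2 : sbound q a (fun y => dl * (Ph dl y * (1 + bub y) `^ (- 1))).
    apply: sbound_le (sbound_scale dl (H2 _ _ Dq)).
    by rewrite gtr0_norm // mulrCA ler_wpM2r //; lra.
  have b2 : - 2^-1 <= dl * (Ph dl q * (1 + bub q) `^ (- 1)).
    by have := sbound_abs f2; rewrite ler_norml => /andP[? _]; lra.
  split.
    have [E0 _ _] := X_1 qw; rewrite /eta E0 mul1r pert_factor.
    by rewrite mulr_gt0 //; [rewrite ltr_wpDr // powR_ge0|lra].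
  apply: sbound_near (sbound_quotient (- pexp) a2 f1 f2).
  have [d [/is_derive_cont cf2 _ _]] := f2.
  near=> y; rewrite curv_central //.
  + by near: y; exact: lt_nbhsr.
  + rewrite mulrC -ltr_pdivlMr //; near: y; apply: lt_nbhsl.
    by rewrite ltr_pdivlMr // mulrC.
  + rewrite -lerBlDl sub0r; apply: ltW.
    by near: y; apply: (cvgr_gt _ cf2); lra.
- have Oq : outer dl q.
    have [[_ _ _ q1]|//] := concentratedP Dq.
    by have : dl * q <= dl by [rewrite ler_piMr // ltW]; lra.
  have Fq : far dl q by [].
  have [_ _ q1 _] := Oq.
  have tq : dl <= t.
    by rewrite /t ler_peMr ?(ltW d0) //; apply: outer_powR_ge1 Oq; lra.
  have f1 : sbound q a (far_defect dl).
    apply: sbound_le (H3 _ _ Fq); apply: ler_pM => //; [exact: ltW|lra].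
  have f2 : sbound q a (fun y => X (dl * y) * pert dl y).
    apply: sbound_le (H4 _ _ Fq); apply: ler_pM => //; [exact: ltW|lra].
  split.
    have := sbound_abs f2; rewrite ler_norml => /andP[b _].
    by rewrite /eta; lra.
  apply: sbound_ext q0 _ (sbound_quotient (- pexp) a2 f1 f2) => y y0.
  by rewrite /curv confL_eta.
Unshelve. all: by end_near. Qed.

End FixedCorrection.
End Profile.

Section RadialProfile.
Variables (R : realType) (m : R).
Hypothesis hm : 3 <= m.
Implicit Types dl q x y w : R.

Lemma cutoff_derivatives (w1 w2 : R) : w1 < w2 ->
  exists X X1 X2 X3 : R -> R, exists CX : R,
  [/\ [/\ forall x, is_derive x 1 X (X1 x), forall x, is_derive x 1 X1 (X2 x),
          forall x, is_derive x 1 X2 (X3 x) & Cline setT X],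
      0 <= CX, forall x, 0 <= x <= 1 ->
        [/\ `|X x| <= CX, `|X1 x| <= CX, `|X2 x| <= CX & `|X3 x| <= CX],
      forall x, x < w1 -> [/\ X x = 1, X1 x = 0 & X2 x = 0]
    & forall x, w2 < x -> [/\ X x = 0, X1 x = 0 & X2 x = 0]].
Proof.
move=> ww; have [X [CX X1 X0]] := smooth_cutoff ww.
have CD (f : R -> R) : Cline setT f -> Cline setT (fun x => 'D_1 f x).
  move=> Cf; apply: (Cline_derive openT Cf) => x _.
  exact: Cline_is_derive Cf I.
have dD (f : R -> R) : Cline setT f -> forall x, is_derive x 1 f ('D_1 f x).
  by move=> Cf x; exact: Cline_is_derive Cf I.
pose Y1 x := 'D_1 X x; pose Y2 x := 'D_1 Y1 x; pose Y3 x := 'D_1 Y2 x.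
have CY1 : Cline setT Y1 by exact: CD.
have CY2 : Cline setT Y2 by exact: CD.
have CY3 : Cline setT Y3 by exact: CD.
have bd (f : R -> R) : Cline setT f ->
    exists C, 0 <= C /\ forall x, 0 <= x <= 1 -> `|f x| <= C.
  move=> Cf; have cf : ({within `[0, 1], continuous (fun x => `|f x|)})%classic.
    apply: continuous_in_subspaceT => x _.
    apply: (@continuous_comp _ _ _ f Num.norm); last exact: norm_continuous.
    exact: (Ck_cont (Cf 0%N)).
  have [c _ Hc] := EVT_max ler01 cf.
  by exists `|f c|; split=> // x x01; apply: Hc; rewrite in_itv.
have [C0 [C00 B0]] := bd _ CX; have [C1 [C10 B1]] := bd _ CY1.
have [C2 [C20 B2]] := bd _ CY2; have [C3 [C30 B3]] := bd _ CY3.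
have cst0 (f : R -> R) (c x : R) : (\near x, f x = c) -> 'D_1 f x = 0.
  move=> fc; rewrite (near_eq_derive _ fc); exact: derive_cst.
have lo x : x < w1 -> [/\ X x = 1, Y1 x = 0 & Y2 x = 0].
  move=> xw; have Y0 y : y < w1 -> Y1 y = 0.
    move=> yw; apply: (cst0 _ 1); near=> z; apply: X1.
    by apply: ltW; near: z; exact: lt_nbhsl.
  split; [exact/X1/ltW|exact: Y0|]; apply: (cst0 _ 0); near=> z; apply: Y0.
  by near: z; exact: lt_nbhsl.
have hi x : w2 < x -> [/\ X x = 0, Y1 x = 0 & Y2 x = 0].
  move=> xw; have Y0 y : w2 < y -> Y1 y = 0.
    move=> yw; apply: (cst0 _ 0); near=> z; apply: X0.
    by apply: ltW; near: z; exact: lt_nbhsr.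
  split; [exact/X0/ltW|exact: Y0|]; apply: (cst0 _ 0); near=> z; apply: Y0.
  by near: z; exact: lt_nbhsr.
exists X, Y1, Y2, Y3, (C0 + C1 + C2 + C3); split=> //.
- by split=> // x; exact: dD.
- by rewrite !addr_ge0.
- move=> x x01; have [c0 c1 c2 c3] : [/\ C0 <= C0 + C1 + C2 + C3,
    C1 <= C0 + C1 + C2 + C3, C2 <= C0 + C1 + C2 + C3 & C3 <= C0 + C1 + C2 + C3].
    by clear -C00 C10 C20 C30; split; lra.
  split; [exact: le_trans (B0 x x01) c0|exact: le_trans (B1 x x01) c1
         |exact: le_trans (B2 x x01) c2|exact: le_trans (B3 x x01) c3].
Unshelve. all: by end_near. Qed.

Lemma exists_small (a b c d : R) : 0 < a -> 0 < b -> 0 < c -> 0 < d ->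
  exists x, [/\ 0 < x, x < a, x < b, x < c & x < d].
Proof.
move=> a0 b0 c0 d0; exists (Num.min (Num.min a b) (Num.min c d) / 2).
have : Num.min (Num.min a b) (Num.min c d) <= a by rewrite !ge_min lexx.
have : Num.min (Num.min a b) (Num.min c d) <= b by rewrite !ge_min lexx !orbT.
have : Num.min (Num.min a b) (Num.min c d) <= c by rewrite !ge_min lexx !orbT.
have : Num.min (Num.min a b) (Num.min c d) <= d by rewrite !ge_min lexx !orbT.
have : 0 < Num.min (Num.min a b) (Num.min c d) by rewrite !lt_min a0 b0 c0 d0.
set y := Num.min _ _; move=> *; split; lra.
Qed.

Definition curvature dl (h h1 h2 : R -> R) q :=
  confL m dl h h1 h2 q * h q `^ (- pexp m).

(** The last two fields say that the solution is positive and, with the bound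
    [4 q / dl] on the squared gradient of [q], that its curvature is
    [2]-Lipschitz. *)
Record profile_spec dl w M (h h1 h2 : R -> R) : Prop := ProfileSpec {
  profile_itv : 0 < dl < 1;
  profile_d1 : forall q, dl / 2 < q -> is_derive q 1 h (h1 q);
  profile_d2 : forall q, dl / 2 < q -> is_derive q 1 h1 (h2 q);
  profile_smooth : Cline [set q | dl / 2 < q]%classic h;
  profile_far : forall q, w < dl * q -> h q = 1 /\ curvature dl h h1 h2 q = 1;
  profile_peak : M <= h dl;
  profile_gt0 : forall q, concentrated dl q -> 0 < h q;
  profile_lip : forall q, concentrated dl q ->
    exists d, is_derive q 1 (curvature dl h h1 h2) d /\ d ^+ 2 * q <= dl }.

Lemma radial_profile w M : 0 < w -> exists dl h h1 h2, profile_spec dl w M h h1 h2.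
Proof.
move=> w0; have w1w : w / 2 < w by lra.
have w10 : 0 < w / 2 by lra.
have [X [X1 [X2 [X3 [CX [[dX dX1 dX2 SX] CX0 XB Xlo Xhi]]]]]] :=
  cutoff_derivatives w1w.
have /choice [FP HFP] : forall dl, exists FP : (R -> R) * (R -> R),
    0 < dl < 1 -> is_correction m dl FP.1 FP.2.
  move=> dl; have [d01|d01] := boolP (0 < dl < 1); last by exists (id, id).
  by have [FP H] := correction_exists m d01; exists FP.
pose F dl := (FP dl).1; pose Ph dl := (FP dl).2.
have [C [C0 H]] := curv_bound hm (F := F) (Ph := Ph) HFP dX dX1 dX2 CX0 XB w10 Xlo.
have [C' [C0' H']] := corr_inner hm (F := F) (Ph := Ph) HFP.
set pc := 1 + 3 * pow_const (- pexp m) in H.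
have pc1 : 1 <= pc by rewrite lerDl mulr_ge0 // pow_const_ge0.
pose K := pc * C; have K0 : 0 <= K by rewrite mulr_ge0 // (le_trans ler01).
have CK : C <= K by rewrite /K ler_peMl.
have M0 : 0 < `|M| + C' + 1 by rewrite ltr_wpDl ?addr_ge0.
have K4 : 0 < 4 * (K + 1) ^+ 2 by rewrite mulr_gt0 // exprn_gt0 // ltr_wpDl.
(* The bounds on [dl] make [X] equal to [1] at the centre, the peak at least
   [M], and the relative error at most [1 / 2]. *)
have [||dl [d0 d1 dw dM dK]] := @exists_small 1 (w / 2) (`|M| + C' + 1)^-1
  (4 * (K + 1) ^+ 2)^-1 ltr01 w10; rewrite ?invr_gt0 ?K4 ?M0 //.
have d01 : 0 < dl < 1 by rewrite d0 d1.
have Kd : 4 * (K + 1) ^+ 2 * dl < 1.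
  by rewrite mulrC -ltr_pdivlMr ?div1r.
have K2 : K ^+ 2 * dl <= 1 / 4 by nra.
exists dl, (eta m Ph X dl), (eta1 m F Ph X X1 dl), (eta2 m F Ph X X1 X2 dl).
have half q : concentrated dl q -> (q `^ (1 / 2)) ^+ 2 = q.
  by move=> /concentrated_gt0 q0; rewrite expr2 powRD_gt0 // -splitr powRr1 // ltW.
have dq1 q : concentrated dl q -> dl * q <= 1.
  by case=> _ _ _ /(ler_wpM2l (ltW d0)) /le_trans; apply; rewrite divff // gt_eqF.
have est q : concentrated dl q -> C * (dl * q `^ (1 / 2)) <= 2^-1.
  move=> Dq; have q0 := concentrated_gt0 Dq.
  have x0 := powR_ge0 q (1 / 2); have xx := half q Dq.
  have := dq1 q Dq; set x := q `^ _ in x0 xx *; move=> xq.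
  have C2 : (C * (dl * x)) ^+ 2 <= 2^-1 ^+ 2.
    have -> : (C * (dl * x)) ^+ 2 = C ^+ 2 * dl * (dl * x ^+ 2) by ring.
    rewrite xx; have : C ^+ 2 * dl <= 1 / 4.
      apply: le_trans K2; rewrite ler_wpM2r ?(ltW d0) //.
      by rewrite ler_sqr ?nnegrE.
    have : 0 <= C ^+ 2 * dl by rewrite mulr_ge0 ?sqr_ge0 // ltW.
    have : 0 <= dl * q by rewrite mulr_ge0 // ltW.
    nra.
  by move: C2; rewrite ler_sqr ?nnegrE ?mulr_ge0 ?(ltW d0) // invr_ge0.
have D0 : concentrated dl dl.
  by split=> //; rewrite -(@ler_pM2r _ dl) // mulVf ?gt_eqF //; nra.
split=> //.
- by move=> q dq; exact: (is_derive_eta HFP dX d01 dq).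
- by move=> q dq; exact: (is_derive_eta1 HFP dX dX1 d01 dq).
- have oD : open [set q : R | dl / 2 < q]%classic by exact: open_gt.
  have D_gt q : dl / 2 < q -> 0 < q by lra.
  have sub : ([set q : R | dl / 2 < q] `<=` [set q | 0 < q])%classic by exact: D_gt.
  have [_ _ dF dP] := HFP dl d01.
  have CF : Cline [set q : R | dl / 2 < q]%classic (F dl).
    apply: (Cline_primitive oD dF) => k.
    exact: Ck_sub sub (Cline_flux_rhs m k).
  have CP : Cline [set q : R | dl / 2 < q]%classic (Ph dl).
    apply: (Cline_primitive oD dP); apply: (Coo_mul oD (Coo_cst _ _ oD) _).
    by apply: (Coo_mul oD _ CF) => k; exact: Ck_sub sub (@Cline_powR R _ k).
  apply: (Coo_add oD (Coo_cst _ _ oD) _); apply: (Coo_mul oD _ _).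
    apply: (Cline_comp (f := fun q => dl * q) oD _ _ SX) => //.
    exact: Coo_mul oD (Coo_cst _ _ oD) (Cline_id oD).
  apply: (Coo_add oD _ (Coo_mul oD (Coo_cst _ _ oD) CP)) => k.
  exact: Ck_sub sub (@Cline_powR R _ k).
- by move=> q; exact: eta_far.
- have [E0 _ _] : [/\ X (dl * dl) = 1, X1 (dl * dl) = 0 & X2 (dl * dl) = 0].
    by apply: Xlo; nra.
  rewrite /eta E0 mul1r /pert.
  have B : `|dl * Ph dl dl| <= C'.
    have Di : inner dl dl by split=> //; exact: ltW.
    have := sbound_abs (H' dl dl Di); rewrite normrM gtr0_norm //.
    move=> /(ler_wpM2l (ltW d0)) /le_trans; apply.
    by rewrite powR_inv1 ?(ltW d0) // mulrCA divff ?mulr1 // gt_eqF.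
  have T : dl^-1 <= bub m dl.
    rewrite -powR_inv1 ?(ltW d0) //.
    by apply: (inner_powR (dl := dl)); [move: hm; lra|split=> //; exact: ltW].
  have dM' : `|M| + C' + 1 < dl^-1.
    by rewrite -[ltLHS]invrK ltf_pV2 ?posrE // invr_gt0.
  have := ler_norm M; move: B; rewrite ler_norml => /andP[B _]; lra.
- by move=> q Dq; have [] := H dl q Dq dw (est q Dq).
- move=> q Dq; have [_ [d [Dd _ dB]]] := H dl q Dq dw (est q Dq).
  have q0 := concentrated_gt0 Dq.
  exists d; split.
    have := is_derive_add Dd (is_derive_cstE (1 : R) q (1 : R)).
    rewrite addr0; apply: is_derive_ext => y; by rewrite subrK.
  have : (q * d) ^+ 2 <= (K * (dl * q `^ (1 / 2))) ^+ 2.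
    rewrite -[leLHS]real_normK ?num_real // ler_sqr ?nnegrE //.
      by rewrite /K -mulrA.
    by rewrite mulr_ge0 // mulr_ge0 ?powR_ge0 // ltW.
  have -> : (K * (dl * q `^ (1 / 2))) ^+ 2 =
      K ^+ 2 * dl * dl * (q `^ (1 / 2)) ^+ 2 by ring.
  rewrite half //; have -> : (q * d) ^+ 2 = (d ^+ 2 * q) * q by ring.
  rewrite ler_pM2r // => /le_trans; apply.
  by rewrite ler_piMl ?(ltW d0) //; lra.
Qed.

End RadialProfile.

(** * Calculus on Euclidean space *)

Section AlongLine.
Variables (R : realType) (V : normedModType R).

Lemma is_derive_along (f : V -> R) (x v : V) (t d : R) :
  is_derive (t *: v + x) v f d -> is_derive t 1 (fun t : R => f (t *: v + x)) d.
Proof.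
move=> [d1 d2].
have d0 : is_derive (t - t) 1 (fun r : R => f (r *: v + (t *: v + x))) d.
  rewrite subrr; apply: DeriveDef; first exact: ((derivable1P _ _ _).1 d1).
  by rewrite -derive_lineE.
have ds := is_derive_add (is_derive_id t (1 : R)) (is_derive_cstE (- t) t (1 : R)).
have := is_derive_comp ds d0; rewrite addr0 mulr1.
by apply: is_derive_ext => r; rewrite addrA -scalerDl subrK.
Qed.

Lemma is_derive_bigsum (I : Type) (s : seq I) (f : I -> V -> R) (df : I -> R)
    (x v : V) : (forall i, is_derive x v (f i) (df i)) ->
  is_derive x v (fun y => \sum_(i <- s) f i y) (\sum_(i <- s) df i).
Proof.
move=> H; elim: s => [|i s IH].
  rewrite big_nil; apply: is_derive_ext (is_derive_cstE 0 x v) => y.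
  by rewrite big_nil.
rewrite big_cons; apply: is_derive_ext (is_derive_add (H i) IH) => y.
by rewrite big_cons.
Qed.

End AlongLine.

Section Euclidean.
Variables (R : realType) (n : nat).
Local Notation V := 'rV[R]_n.
Implicit Types (x y z v xi : V).

Definition dotv x y : R := \sum_(i < n) x 0 i * y 0 i.

Lemma dotvC x y : dotv x y = dotv y x.
Proof. by apply: eq_bigr => i _; rewrite mulrC. Qed.

Lemma dotvv_ge0 x : 0 <= dotv x x.
Proof. by apply: sumr_ge0 => i _; rewrite -expr2 sqr_ge0. Qed.

Lemma dotvDl x y z : dotv (x + y) z = dotv x z + dotv y z.
Proof. by rewrite /dotv -big_split; apply: eq_bigr => i _; rewrite mxE mulrDl. Qed.

Lemma dotvZl c x z : dotv (c *: x) z = c * dotv x z.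
Proof. by rewrite /dotv mulr_sumr; apply: eq_bigr => i _; rewrite mxE mulrA. Qed.

Lemma dotvNl x z : dotv (- x) z = - dotv x z.
Proof. by rewrite -scaleN1r dotvZl mulN1r. Qed.

Lemma dotvDr x y z : dotv z (x + y) = dotv z x + dotv z y.
Proof. by rewrite !(dotvC z) dotvDl. Qed.

Lemma dotvZr c x z : dotv z (c *: x) = c * dotv z x.
Proof. by rewrite !(dotvC z) dotvZl. Qed.

Lemma dotvNr x z : dotv z (- x) = - dotv z x.
Proof. by rewrite !(dotvC z) dotvNl. Qed.

Definition dotvE := (dotvDl, dotvDr, dotvNl, dotvNr, dotvZl, dotvZr).

Lemma dotvv_eq0 x : dotv x x = 0 -> x = 0.
Proof.
move=> /eqP; rewrite psumr_eq0 => [|i _]; last by rewrite -expr2 sqr_ge0.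
move=> /allP H; apply/rowP => i; rewrite mxE.
by have := H i (mem_index_enum _); rewrite mulf_eq0 orbb => /eqP.
Qed.

Lemma dotv_cauchy x y : dotv x y ^+ 2 <= dotv x x * dotv y y.
Proof.
have [y0|y0] := eqVneq (dotv y y) 0.
  have -> : y = 0 by exact: dotvv_eq0.
  have -> : dotv x 0 = 0 by rewrite /dotv big1 // => i _; rewrite mxE mulr0.
  by rewrite expr0n mulr_ge0 // dotvv_ge0.
have yp : 0 < dotv y y by rewrite lt_def y0 dotvv_ge0.
rewrite -subr_ge0 -(pmulr_lge0 _ yp).
have -> : (dotv x x * dotv y y - dotv x y ^+ 2) * dotv y y =
   dotv (dotv y y *: x - dotv x y *: y) (dotv y y *: x - dotv x y *: y).
  by rewrite !dotvE (dotvC y x); ring.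
exact: dotvv_ge0.
Qed.

Lemma enormE x : enorm x = Num.sqrt (dotv x x).
Proof. by rewrite /enorm; congr Num.sqrt; apply: eq_bigr => i _; rewrite expr2. Qed.

Lemma enorm_ge0 x : 0 <= enorm x.
Proof. exact: sqrtr_ge0. Qed.

Lemma enorm_sqr x : enorm x ^+ 2 = dotv x x.
Proof. by rewrite enormE sqr_sqrtr // dotvv_ge0. Qed.

Lemma enorm_gt0 x : x != 0 -> 0 < enorm x.
Proof.
move=> x0; rewrite enormE sqrtr_gt0 lt_def dotvv_ge0 andbT.
by apply: contraNneq x0 => /dotvv_eq0 ->.
Qed.

Lemma enormZ c x : 0 <= c -> enorm (c *: x) = c * enorm x.
Proof.
move=> c0; rewrite !enormE !dotvE mulrA -expr2 sqrtrM ?sqr_ge0 //.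
by rewrite sqrtr_sqr ger0_norm.
Qed.

Lemma enormN x : enorm (- x) = enorm x.
Proof. by rewrite !enormE !dotvE opprK. Qed.

Lemma enorm_triangle x y : enorm (x + y) <= enorm x + enorm y.
Proof.
rewrite -(@ler_sqr _ _ _) ?nnegrE ?addr_ge0 ?enorm_ge0 //.
rewrite sqrrD !enorm_sqr !dotvE (dotvC y x).
suff : dotv x y <= enorm x * enorm y by rewrite mulr2n; lra.
apply: le_trans (ler_norm _) _.
rewrite -(@ler_sqr _ _ _) ?nnegrE ?mulr_ge0 ?enorm_ge0 //.
by rewrite real_normK ?num_real // exprMn !enorm_sqr dotv_cauchy.
Qed.

Lemma is_derive_coord i x v : is_derive x v (fun y => y 0 i) (v 0 i).
Proof.
apply: is_derive_line.
have := is_derive_add (is_derive_scale (v 0 i) (is_derive_id (0 : R) (1 : R)))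
                      (is_derive_cstE (x 0 i) (0 : R) (1 : R)).
rewrite mulr1 addr0; apply: is_derive_ext => t.
by rewrite !mxE mulrC.
Qed.

Lemma is_derive_dot_l x v w : is_derive x v (fun y => dotv y w) (dotv v w).
Proof.
apply: is_derive_bigsum => i.
have := is_derive_mul (is_derive_coord i x v) (is_derive_cstE (w 0 i) x v).
by rewrite mulr0 addr0.
Qed.

Lemma is_derive_sqdist xi x v :
  is_derive x v (fun y => dotv (y - xi) (y - xi)) (2 * dotv (x - xi) v).
Proof.
have -> : 2 * dotv (x - xi) v =
   \sum_(i < n) (v 0 i * (x 0 i - xi 0 i) + (x 0 i - xi 0 i) * v 0 i).
  by rewrite /dotv mulr_sumr; apply: eq_bigr => i _; rewrite !mxE; ring.
have H i : is_derive x v (fun y => (y 0 i - xi 0 i) * (y 0 i - xi 0 i))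
   (v 0 i * (x 0 i - xi 0 i) + (x 0 i - xi 0 i) * v 0 i).
  have d := is_derive_add (is_derive_coord i x v) (is_derive_cstE (- xi 0 i) x v).
  by have := is_derive_mul d d; rewrite addr0.
apply: is_derive_ext (is_derive_bigsum (index_enum 'I_n) H) => y.
by apply: eq_bigr => i _; rewrite !mxE.
Qed.

Definition frame (i : 'I_n) : V := delta_mx 0 i.

Lemma frameE i j : frame i 0 j = (i == j)%:R.
Proof. by rewrite /frame mxE eqxx /= eq_sym. Qed.

Lemma dotv_frame x i : dotv x (frame i) = x 0 i.
Proof.
rewrite /dotv (bigD1 i) //= frameE eqxx mulr1 big1 ?addr0 // => j ji.
by rewrite frameE eq_sym (negPf ji) mulr0.
Qed.

Lemma Coo_coord i : Coo frame setT (fun y : V => y 0 i).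
Proof.
case=> [|k]; first by split=> // x _; exact: coord_continuous.
apply: (CkS (f' := fun j _ => frame j 0 i)); first exact: openT.
- by move=> x _; exact: coord_continuous.
- by move=> j x _; exact: is_derive_coord.
- by move=> j; apply: Ck_cst; exact: openT.
Qed.

Lemma Coo_sqdist xi : Coo frame setT (fun y => dotv (y - xi) (y - xi)).
Proof.
have H i : Coo frame setT (fun y : V => y 0 i - xi 0 i).
  exact: Coo_sub openT (Coo_coord i) (Coo_cst _ _ openT).
have := Coo_sum (index_enum 'I_n) openT (fun i => Coo_mul openT (H i) (H i)).
move=> C k; apply: Ck_ext (C k); first exact: openT.
by move=> y _; apply: eq_bigr => i _; rewrite !mxE.
Qed.

Lemma smooth_onP (U : set V) (f : V -> R) : Coo frame U f -> smooth_on U f.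
Proof.
move=> Cf s; have H (k : nat) : Ck frame k U (iter_partial s f).
  elim: s k => [|i s IH] k; first exact: Cf.
  by have [_ /(_ i) []] := IH k.+1.
move=> x Ux; split; first exact: Ck_cont (H 0%N) x Ux.
by move=> i; have [_ /(_ i) [+ _]] := H 1%N; exact.
Qed.

Lemma laplacian_near (U : set V) (f g : V -> R) x : open U -> U x ->
  (forall y, U y -> f y = g y) -> laplacian f x = laplacian g x.
Proof.
move=> oU Ux fg; apply: eq_bigr => i _; rewrite /partial.
have nU y : U y -> nbhs y U by move=> Uy; exact: open_nbhs_nbhs.
apply: near_eq_derive; apply: filterS (nU _ Ux) => y Uy.
by apply: near_eq_derive; apply: filterS (nU _ Uy) => z; exact: fg.
Qed.

Lemma laplacianE (f : V -> R) (f1 f2 : 'I_n -> V -> R) x :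
  (forall i y, is_derive y (frame i) f (f1 i y)) ->
  (forall i, is_derive x (frame i) (f1 i) (f2 i x)) ->
  laplacian f x = \sum_(i < n) f2 i x.
Proof.
move=> d1 d2; apply: eq_bigr => i _; rewrite /partial.
have -> : (fun y => 'D_(delta_mx 0 i) f y) = f1 i.
  by apply/funext => y; have [_ ->] := d1 i y.
by have [_ ->] := d2 i.
Qed.

(** Derivatives in all directions are used, since the segment need not be
    parallel to a coordinate axis. *)
Lemma lipschitz_segment (f : V -> R) (df : V -> V -> R) (L : R) :
  (forall x v, is_derive x v f (df x v)) ->
  (forall x v, `|df x v| <= L * enorm v) ->
  forall x y, `|f x - f y| <= L * enorm (x - y).
Proof.
move=> d B x y; pose v := x - y.
have := growth_comparison (@ler01 R) (f := fun t => f (t *: v + y))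
  (g := fun t => L * enorm v * t) (df := fun t => df (t *: v + y) v)
  (dg := fun=> L * enorm v).
rewrite scale1r scale0r add0r subrK mulr1 mulr0 subr0; apply.
- by move=> t _; exact: is_derive_along.
- move=> t _; have := is_derive_scale (L * enorm v) (is_derive_id t (1 : R)).
  by rewrite mulr1.
- by move=> t _; exact: B.
Qed.

End Euclidean.

(** * A solution concentrated at one point *)

Section Bubble.
Variables (R : realType) (n : nat).
Hypothesis hn : (4 < n)%N.
Local Notation V := 'rV[R]_n.
Local Notation m := (n%:R - 2 : R).
Local Notation frame := (@frame R n).
Implicit Types (x y v xi : V).

Lemma m_ge3 : 3 <= m.
Proof. have : 5 <= n%:R :> R by rewrite ler_nat.
by lra. Qed.

Definition cdist x : R := 1 + dotv x x.

Lemma cdist_ge1 x : 1 <= cdist x.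
Proof. by rewrite lerDl dotvv_ge0. Qed.

Lemma cdist_gt0 x : 0 < cdist x.
Proof. exact: lt_le_trans ltr01 (cdist_ge1 x). Qed.

Definition background x : R := bub m (cdist x).

Lemma background_gt0 x : 0 < background x.
Proof. by rewrite powR_gt0 // cdist_gt0. Qed.

Section OneCentre.
Variables (xi : V) (dl : R) (d01 : 0 < dl < 1).

Let s x := dotv (x - xi) (x - xi).
Let c x := dotv x (x - xi).

Let coef : R := (dl^-1 - dl) / cdist xi.

(** In the round metric [s x / (cdist x * cdist xi)] is [sin^2] of half the
    distance to the centre. *)
Definition qdist x := dl + coef * (s x / cdist x).

Let c_eq x : 2 * c x = cdist x + s x - cdist xi.
Proof.
rewrite /c /s /cdist !dotvE (dotvC xi x); ring.
Qed.

Let d0 : 0 < dl. Proof. by case/andP: d01. Qed.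

Let coef_gt0 : 0 < coef.
Proof.
rewrite divr_gt0 ?cdist_gt0 // subr_gt0; case/andP: d01 => _ d1.
by rewrite (lt_trans d1) // invf_gt1.
Qed.

Let s_ge0 x : 0 <= s x. Proof. exact: dotvv_ge0. Qed.

Let dP x v : is_derive x v cdist (2 * dotv x v).
Proof.
have := is_derive_add (is_derive_cstE (1 : R) x v) (is_derive_sqdist 0 x v).
by rewrite add0r subr0; apply: is_derive_ext => y; rewrite subr0.
Qed.

Let ds x v : is_derive x v s (2 * dotv (x - xi) v).
Proof. exact: is_derive_sqdist. Qed.

Definition qgrad x v :=
  2 * coef * (dotv (x - xi) v / cdist x - s x * dotv x v / cdist x ^+ 2).

Lemma is_derive_qdist x v : is_derive x v qdist (qgrad x v).
Proof.
have P0 : cdist x != 0 by rewrite gt_eqF // cdist_gt0.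
have d := is_derive_scale coef (is_derive_mul (ds x v) (is_derive_inv P0 (dP x v))).
have := is_derive_add (is_derive_cstE dl x v) d.
by move=> /is_derive_eq; apply; rewrite /qgrad; field.
Qed.

Let gradv x : V := (2 * coef / cdist x) *: (x - xi)
  - (2 * coef * s x / cdist x ^+ 2) *: x.

Let qgradE x v : qgrad x v = dotv (gradv x) v.
Proof.
rewrite /gradv /qgrad; move: (x - xi) => z; rewrite dotvDl dotvNl !dotvZl; field.
by rewrite gt_eqF // cdist_gt0.
Qed.

(** The sign of the left side also shows that [q] does not exceed [1 / dl]. *)
Let qgrad_sqr x :
  dotv (gradv x) (gradv x) = 4 * ((qdist x - dl) * (dl^-1 - qdist x)) / cdist x ^+ 2.
Proof.
have -> : dotv (gradv x) (gradv x) = (2 * coef / cdist x) ^+ 2 * s x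
   - 2 * (2 * coef / cdist x) * (2 * coef * s x / cdist x ^+ 2) * c x
   + (2 * coef * s x / cdist x ^+ 2) ^+ 2 * (cdist x - 1).
  have -> : cdist x - 1 = dotv x x by rewrite /cdist addrC addKr.
  rewrite /gradv; move: (2 * coef / _) (2 * coef * _ / _) => a b.
  rewrite /s /c; move: (x - xi) => z.
  by rewrite !dotvE (dotvC z x); ring.
have -> : c x = (cdist x + s x - cdist xi) / 2.
  by rewrite -c_eq; field.
rewrite /qdist /coef; field.
by rewrite !gt_eqF ?cdist_gt0.
Qed.

Lemma qdist_concentrated x : concentrated dl (qdist x).
Proof.
have P0 := cdist_gt0 x; case/andP: d01 => _ d1.
split=> //; first by rewrite lerDl mulr_ge0 ?(ltW coef_gt0) // divr_ge0 // ltW.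
have [s0|s0] := eqVneq (s x) 0.
  by rewrite /qdist s0 mul0r mulr0 addr0 (le_trans (ltW d1)) // invf_ge1 // ltW.
have sp : 0 < s x by rewrite lt_def s0 s_ge0.
have qd : 0 < qdist x - dl.
  by rewrite /qdist addrC addKr mulr_gt0 ?coef_gt0 // divr_gt0.
have := dotvv_ge0 (gradv x).
rewrite qgrad_sqr pmulr_lge0; last by rewrite invr_gt0 exprn_gt0.
by rewrite pmulr_rge0 // pmulr_rge0 // subr_ge0.
Qed.

Lemma qgrad_bound x v : qgrad x v ^+ 2 * dl <= 4 * qdist x * dotv v v.
Proof.
have [_ _ dq qd] := qdist_concentrated x.
rewrite qgradE.
apply: le_trans (ler_wpM2r (ltW d0) (dotv_cauchy (gradv x) v)) _.
rewrite qgrad_sqr mulrAC ler_wpM2r ?dotvv_ge0 //.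
have P2 : 1 <= cdist x ^+ 2 by rewrite exprn_ege1 // cdist_ge1.
have q0 : 0 <= qdist x by apply: le_trans dq; exact: ltW.
rewrite mulrAC ler_pdivrMr ?(lt_le_trans ltr01) //.
apply: (@le_trans _ _ (4 * qdist x)); last first.
  by rewrite ler_peMr // mulr_ge0.
rewrite -!mulrA ler_wpM2l // -[leRHS]mulr1; apply: ler_pM.
- by rewrite subr_ge0.
- by rewrite mulr_ge0 ?subr_ge0 // ltW.
- by rewrite gerBl ltW.
- by rewrite mulrBl mulVf ?gt_eqF // gerBl mulr_ge0 // ltW.
Qed.

Definition qhess x v := 2 * coef *
  (dotv v v / cdist x - 4 * (dotv (x - xi) v * dotv x v) / cdist x ^+ 2
   - s x * dotv v v / cdist x ^+ 2 + 4 * s x * dotv x v ^+ 2 / cdist x ^+ 3).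

Lemma is_derive_qgrad x v : is_derive x v (qgrad ^~ v) (qhess x v).
Proof.
have P0 : cdist x != 0 by rewrite gt_eqF // cdist_gt0.
have P20 : cdist x ^+ 2 != 0 by rewrite expf_neq0.
have da := is_derive_dot_l x v v.
have db : is_derive x v (fun y => dotv (y - xi) v) (dotv v v).
  have := is_derive_add da (is_derive_cstE (- dotv xi v) x v).
  rewrite addr0; apply: is_derive_ext => y; by rewrite dotvDl dotvNl.
have dI := is_derive_inv P0 (dP x v).
have dI2 := is_derive_inv (f := fun y => cdist y ^+ 2) P20 (is_derive_exp 2 (dP x v)).
have := is_derive_scale (2 * coef) (is_derive_add (is_derive_mul db dI)
  (is_derive_opp (is_derive_mul (is_derive_mul (ds x v) da) dI2))).
by move=> /is_derive_eq; apply; rewrite /qhess /=; field.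
Qed.

Variables (w M : R) (h h1 h2 : R -> R).
Hypothesis HP : profile_spec m dl w M h h1 h2.

Let q_half x : dl / 2 < qdist x.
Proof. by have [_ _ dq _] := qdist_concentrated x; move: d0; lra. Qed.

Definition bubble x := background x * h (qdist x).

Definition bubble1 v x := bub1 m (cdist x) * (2 * dotv x v) * h (qdist x)
  + background x * (h1 (qdist x) * qgrad x v).

Definition bubble2 v x :=
  bub2 m (cdist x) * (2 * dotv x v) ^+ 2 * h (qdist x)
  + bub1 m (cdist x) * (2 * dotv v v) * h (qdist x)
  + 2 * (bub1 m (cdist x) * (2 * dotv x v) * (h1 (qdist x) * qgrad x v))
  + background x * (h2 (qdist x) * qgrad x v ^+ 2 + h1 (qdist x) * qhess x v).

Lemma is_derive_bubble x v : is_derive x v bubble (bubble1 v x).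
Proof.
have dB := is_derive_comp (dP x v) (is_derive_bub m (cdist_gt0 x)).
have dh := is_derive_comp (is_derive_qdist x v) (profile_d1 HP (q_half x)).
exact: is_derive_mul dB dh.
Qed.

Lemma is_derive_bubble1 x v : is_derive x v (bubble1 v) (bubble2 v x).
Proof.
have dB := is_derive_comp (dP x v) (is_derive_bub m (cdist_gt0 x)).
have dB1 := is_derive_comp (dP x v) (is_derive_bub1 m (cdist_gt0 x)).
have dh := is_derive_comp (is_derive_qdist x v) (profile_d1 HP (q_half x)).
have dh1 := is_derive_comp (is_derive_qdist x v) (profile_d2 HP (q_half x)).
have da := is_derive_scale 2 (is_derive_dot_l x v v).
have := is_derive_add (is_derive_mul (is_derive_mul dB1 da) dh)
  (is_derive_mul dB (is_derive_mul dh1 (is_derive_qgrad x v))).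
by move=> /is_derive_eq; apply; rewrite /bubble2 /background; ring.
Qed.

(** The second derivative of a bubble along the i-th axis is such an
    expression, with coefficients that do not depend on i. *)
Let sum_quadratic x (al be ga de : R) :
  \sum_(i < n) (al + be * x 0 i ^+ 2 + ga * (x 0 i * (x - xi) 0 i)
                + de * (x - xi) 0 i ^+ 2)
  = n%:R * al + be * (cdist x - 1) + ga * c x + de * s x.
Proof.
rewrite !big_split /= sumr_const card_ord mulr_natl -!mulr_sumr.
have -> : cdist x - 1 = dotv x x by rewrite /cdist addrC addKr.
by congr (_ + _ * _ + _ * _ + _ * _); apply: eq_bigr => i _; rewrite expr2.
Qed.

(** The conformal covariance of the Laplacian, for radial functions around
    [xi] on the sphere. *)
Lemma laplacian_bubble x : laplacian bubble x =
  - (n%:R * m) * (background x / cdist x ^+ 2) * confL m dl h h1 h2 (qdist x).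
Proof.
have P0 : cdist x != 0 by rewrite gt_eqF // cdist_gt0.
have m0 : m != 0 by rewrite gt_eqF // (lt_le_trans _ m_ge3).
have mn0 : m + 2 != 0 by rewrite gt_eqF // ltr_wpDr // (lt_le_trans _ m_ge3).
have -> : laplacian bubble x = \sum_(i < n) bubble2 (frame i) x.
  exact: (@laplacianE R n bubble (fun i => bubble1 (frame i))
    (fun i => bubble2 (frame i)) x (fun i y => is_derive_bubble y (frame i))
    (fun i => is_derive_bubble1 x (frame i))).
set B := background x; set H := h (qdist x); set H1 := h1 (qdist x).
set H2 := h2 (qdist x); set P := cdist x.
pose al := - (m / 2) * (B / P) * 2 * H + B * H1 * (2 * coef) * (1 / P - s x / P ^+ 2).
pose be := m / 2 * (m / 2 + 1) * (B / P ^+ 2) * 4 * H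
  + 2 * (- (m / 2) * (B / P)) * 2 * H1 * (2 * coef) * (- s x / P ^+ 2)
  + B * H2 * (4 * coef ^+ 2) * s x ^+ 2 / P ^+ 4
  + B * H1 * (2 * coef) * (4 * s x / P ^+ 3).
pose ga := 2 * (- (m / 2) * (B / P)) * 2 * H1 * (2 * coef) / P
  - B * H2 * (4 * coef ^+ 2) * (2 * s x) / P ^+ 3
  - B * H1 * (2 * coef) * 4 / P ^+ 2.
pose de := B * H2 * (4 * coef ^+ 2) / P ^+ 2.
transitivity (\sum_(i < n) (al + be * x 0 i ^+ 2 + ga * (x 0 i * (x - xi) 0 i)
                + de * (x - xi) 0 i ^+ 2)).
  apply: eq_bigr => i _; rewrite /bubble2 /qgrad /qhess !dotv_frame frameE eqxx mulr1n.
  rewrite /al /be /ga /de /bub2 /bub1 -/(background x) -/B -/H -/H1 -/H2 -/P.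
  by move: ((x - xi) 0 i) (x 0 i) => b a; field.
rewrite sum_quadratic.
have -> : c x = (cdist x + s x - cdist xi) / 2 by rewrite -c_eq; field.
rewrite /al /be /ga /de /confL -/H -/H1 -/H2 -/P /qdist -/P /coef.
have X0 : cdist xi != 0 by rewrite gt_eqF // cdist_gt0.
have dn0 : dl != 0 by rewrite gt_eqF.
by field; rewrite P0 m0 mn0 X0 dn0.
Qed.

Definition bubbleK x := curvature m dl h h1 h2 (qdist x).

Lemma bubble_gt0 x : 0 < bubble x.
Proof.
by rewrite mulr_gt0 ?background_gt0 // (profile_gt0 HP) //; exact: qdist_concentrated.
Qed.

Lemma bubble_equation x : laplacian bubble x + n%:R * (n%:R - 2) * bubbleK x
  * bubble x `^ ((n%:R + 2) / (n%:R - 2)) = 0.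
Proof.
have m0 : m != 0 by rewrite gt_eqF // (lt_le_trans _ m_ge3).
have -> : (n%:R + 2) / (n%:R - 2) = pexp m by rewrite /pexp; field.
have H0 : 0 < h (qdist x) by rewrite (profile_gt0 HP) //; exact: qdist_concentrated.
rewrite laplacian_bubble /bubble powRM ?(ltW H0) ?(ltW (background_gt0 x)) //.
have P0 := cdist_gt0 x.
have -> : background x `^ pexp m = background x / cdist x ^+ 2.
  rewrite /background bub_pexp ?m_ge3 // opprD -powRD_gt0 //; congr (_ * _).
  by rewrite powRN -powR_mulrn ?(ltW P0).
rewrite /bubbleK /curvature powRN; field.
by rewrite (gt_eqF (powR_gt0 _ H0)) gt_eqF.
Qed.

Let Coo_cdist : Coo frame setT cdist.
Proof.
move=> k; apply: Ck_ext (Ck_add openT (Ck_cst frame k 1 openT) (Coo_sqdist 0 k)).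
  exact: openT.
by move=> y _; rewrite subr0.
Qed.

Let Coo_cdist_powR (a : R) : Coo frame setT (fun x => cdist x `^ a).
Proof.
apply: (Coo_comp (f := cdist) openT _ Coo_cdist (@Cline_powR R a)) => x _.
exact: cdist_gt0.
Qed.

Let Coo_qdist : Coo frame setT qdist.
Proof.
have C := Coo_add openT (Coo_cst frame dl openT) (Coo_mul openT
  (Coo_cst frame coef openT) (Coo_mul openT (Coo_sqdist xi) (Coo_cdist_powR (- 1)))).
move=> k; apply: Ck_ext (C k); first exact: openT.
by move=> y _; rewrite powR_inv1 // ltW // cdist_gt0.
Qed.

Let Coo_radial (g : R -> R) : Cline [set q : R | dl / 2 < q]%classic g ->
  Coo frame setT (fun x => g (qdist x)).
Proof.
by move=> Cg; apply: (Coo_comp (f := qdist) openT _ Coo_qdist Cg) => x _; exact: q_half.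
Qed.

Lemma Coo_bubble : Coo frame setT bubble.
Proof.
apply: (Coo_mul openT (Coo_cdist_powR _)); apply: Coo_radial.
exact: profile_smooth HP.
Qed.

Lemma Coo_bubbleK : Coo frame setT bubbleK.
Proof.
have oD : open [set q : R | dl / 2 < q]%classic by exact: open_gt.
have C0 := profile_smooth HP.
have C1 : Cline [set q : R | dl / 2 < q]%classic h1.
  by apply: (Cline_derive oD C0) => q; exact: profile_d1 HP q.
have C2 : Cline [set q : R | dl / 2 < q]%classic h2.
  by apply: (Cline_derive oD C1) => q; exact: profile_d2 HP q.
have CC (a : R) : Cline [set q : R | dl / 2 < q]%classic (fun=> a).
  exact: Coo_cst.
have Cq := Cline_id oD.
apply: (Coo_mul openT).
  apply: Coo_radial; apply: (Coo_sub oD C0); apply: (Coo_mul oD (CC _)).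
  apply: (Coo_add oD).
    exact: (Coo_mul oD (Coo_mul oD (Coo_sub oD Cq (CC _)) (Coo_sub oD (CC _) Cq)) C2).
  exact: (Coo_mul oD (Coo_mul oD (CC _) (Coo_sub oD (CC _) (Coo_mul oD (CC _) Cq))) C1).
apply: (Coo_comp (f := fun x => h (qdist x)) openT _ (Coo_radial C0)
  (@Cline_powR R _)) => x _.
by rewrite /= (profile_gt0 HP) //; exact: qdist_concentrated.
Qed.

Lemma bubbleK_lipschitz x y : `|bubbleK x - bubbleK y| <= 2 * enorm (x - y).
Proof.
have /choice [D HD] : forall q, exists d, concentrated dl q ->
    is_derive q 1 (curvature m dl h h1 h2) d /\ d ^+ 2 * q <= dl.
  move=> q; have [Dq|Dq] := pselect (concentrated dl q); last by exists 0.
  by have [d Hd] := profile_lip HP Dq; exists d.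
apply: (lipschitz_segment (df := fun x v => D (qdist x) * qgrad x v)) => z v.
  have [dD _] := HD _ (qdist_concentrated z).
  exact: is_derive_comp (is_derive_qdist z v) dD.
have [_ dB] := HD _ (qdist_concentrated z).
have := qgrad_bound z v; move: (qgrad z v) => g gB.
rewrite -(@ler_sqr _ _ _) ?nnegrE ?mulr_ge0 ?enorm_ge0 //.
rewrite real_normK ?num_real // !exprMn enorm_sqr.
rewrite -(@ler_pM2r _ dl) // -mulrA.
apply: le_trans (ler_wpM2l (sqr_ge0 _) gB) _.
have := ler_wpM2r (dotvv_ge0 v) dB; nra.
Qed.

Lemma bubble_far x : w < s x / (cdist x * cdist xi) ->
  bubble x = background x /\ bubbleK x = 1.
Proof.
move=> wx; have [_ d1] := andP d01.
have P0 := cdist_gt0 x; have X0 := cdist_gt0 xi.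
have [|e1 e2] := profile_far HP (q := qdist x); last by rewrite /bubble e1 mulr1.
apply: lt_le_trans wx _.
have -> : dl * qdist x = s x / (cdist x * cdist xi)
    + dl * dl * (1 - s x / (cdist x * cdist xi)).
  by rewrite /qdist /coef; field; rewrite !gt_eqF.
rewrite lerDl; apply: mulr_ge0; first by rewrite mulr_ge0 // ltW.
have [_ _ _ qd] := qdist_concentrated x.
have := ler_wpM2l (ltW d0) qd; rewrite divff ?gt_eqF //.
have -> : dl * qdist x = dl * dl + (1 - dl * dl) * (s x / (cdist x * cdist xi)).
  by rewrite /qdist /coef; field; rewrite !gt_eqF.
have dd : 0 < 1 - dl * dl by rewrite subr_gt0; move: d0 d1; nra.
rewrite -lerBrDl -subr_ge0 -{1}[1 - dl * dl]mulr1 -mulrBr pmulr_rge0 // subr_ge0.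
Qed.

Lemma bubble_peak : background xi * M <= bubble xi.
Proof.
rewrite /bubble ler_wpM2l ?(ltW (background_gt0 xi)) //.
have -> : qdist xi = dl.
  by rewrite /qdist /s /dotv big1 ?mul0r ?mulr0 ?addr0 // => i _; rewrite subrr mxE mul0r.
exact: profile_peak HP.
Qed.

End OneCentre.
End Bubble.

(** * Infinitely many bubbles accumulating at the origin *)

Section Gluing.
Variables (R : realType) (n : nat).
Hypothesis hn : (4 < n)%N.
Local Notation V := 'rV[R]_n.
Local Notation background := (@background R n).
Implicit Types (x y xi : V).

Record bubble_spec xi (rho L : R) (K u : V -> R) : Prop := BubbleSpec {
  bubble_spec_K : Coo (@frame R n) setT K;
  bubble_spec_u : Coo (@frame R n) setT u;
  bubble_spec_gt0 : forall x, 0 < u x;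
  bubble_spec_eq : forall x, laplacian u x + n%:R * (n%:R - 2) * K x
    * u x `^ ((n%:R + 2) / (n%:R - 2)) = 0;
  bubble_spec_lip : forall x y, `|K x - K y| <= 2 * enorm (x - y);
  bubble_spec_far : forall x, rho <= enorm (x - xi) ->
    u x = background x /\ K x = 1;
  bubble_spec_peak : L <= u xi }.

(** The radius of the support and the height of the peak are independent of
    the Lipschitz constant [2]. *)
Lemma bubble_exists xi (rho L : R) : 0 < rho -> enorm xi <= 1 ->
  exists K u, bubble_spec xi rho L K u.
Proof.
(* [s / (6 + 4 s)] increases with the squared distance [s] and is a lower bound
   for [sin^2] of half the spherical distance when [enorm xi <= 1]. *)
move=> r0 xi1; pose w := rho ^+ 2 / (6 + 4 * rho ^+ 2) / 2.
have r2 : 0 < rho ^+ 2 by rewrite exprn_gt0.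
have D0 : 0 < 6 + 4 * rho ^+ 2 by lra.
have w0 : 0 < w by rewrite !divr_gt0.
have [dl [h [h1 [h2 HP]]]] := radial_profile (m_ge3 R hn) (L / background xi) w0.
have d01 := profile_itv HP.
exists (bubbleK xi dl h h1 h2), (bubble xi dl h); split.
- exact: Coo_bubbleK HP.
- exact: Coo_bubble HP.
- exact: bubble_gt0 HP.
- exact: bubble_equation HP.
- exact: bubbleK_lipschitz HP.
- move=> x rx; apply: bubble_far HP _ _ => //.
  have X1 := cdist_gt0 xi; have P0 := cdist_gt0 x.
  rewrite ltr_pdivlMr ?mulr_gt0 //; set s := dotv (x - xi) (x - xi).
  have sr : rho ^+ 2 <= s.
    by rewrite /s -enorm_sqr ler_sqr ?nnegrE ?enorm_ge0 // ltW.
  have xx : dotv xi xi <= 1.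
    by rewrite -enorm_sqr -[leRHS](expr1n _ 2) ler_sqr ?nnegrE ?enorm_ge0.
  have px : dotv x x <= 2 * s + 2 * dotv xi xi.
    rewrite -subr_ge0; have -> : 2 * s + 2 * dotv xi xi - dotv x x =
      dotv (x - 2 *: xi) (x - 2 *: xi).
      by rewrite /s !dotvE (dotvC xi x); ring.
    exact: dotvv_ge0.
  have Pb : cdist x * cdist xi <= 6 + 4 * s.
    have := dotvv_ge0 x; have := dotvv_ge0 xi; rewrite /cdist; nra.
  apply: le_lt_trans (ler_wpM2l (ltW w0) Pb) _.
  have -> : w * (6 + 4 * s) = rho ^+ 2 * (6 + 4 * s) / (2 * (6 + 4 * rho ^+ 2)).
    by rewrite /w; field; rewrite gt_eqF.
  have : 0 <= s * rho ^+ 2 by rewrite mulr_ge0 ?(ltW r2) // (le_trans (ltW r2)).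
  by rewrite ltr_pdivrMr ?mulr_gt0 //; lra.
- have b0 := background_gt0 xi.
  by have := bubble_peak xi HP; rewrite mulrCA divff ?mulr1 // gt_eqF.
Qed.

Variables (eps : R) (heps : 0 < eps).

Let tau : R := Num.min 2^-1 eps.

Let tau_gt0 : 0 < tau. Proof. by rewrite lt_min heps invr_gt0 ltr0n. Qed.

Let v0 : V := frame R (Ordinal (ltn_trans (isT : (0 < 4)%N) hn)).

Let enorm_v0 : enorm v0 = 1.
Proof.
by rewrite enormE dotv_frame frameE eqxx sqrtr1.
Qed.

Let rad (j : nat) : R := tau / 4 ^+ j.
Let ctr (j : nat) : V := rad j *: v0.
Let ball j : set V := [set x | enorm (x - ctr j) < rad j / 4]%classic.

Let rad_gt0 j : 0 < rad j.
Proof. by rewrite divr_gt0 // exprn_gt0. Qed.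

Let rad_le j : rad j <= tau.
Proof.
by rewrite ler_pdivrMr ?exprn_gt0 // ler_peMr ?(ltW tau_gt0) // exprn_ege1 // ler1n.
Qed.

Let radS j : rad j = 4 * rad j.+1.
Proof. by rewrite /rad exprS; field; rewrite gt_eqF // exprn_gt0. Qed.

Let rad_lt i j : (i < j)%N -> 4 * rad j <= rad i.
Proof.
move=> ij; rewrite /rad -(subnKC ij) exprD exprS invfM invfM.
have e0 : 0 < 4 ^+ i :> R by rewrite exprn_gt0.
have e1 : 1 <= 4 ^+ (j - i.+1) :> R by rewrite exprn_ege1 // ler1n.
have -> : 4 * (tau * (4^-1 * (4 ^+ i)^-1 * (4 ^+ (j - i.+1))^-1)) =
  tau / 4 ^+ i * (4 ^+ (j - i.+1))^-1.
  by field; rewrite !gt_eqF // (lt_le_trans ltr01).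
by rewrite ler_piMr ?invf_le1 ?(lt_le_trans ltr01) // divr_ge0 // ltW.
Qed.

Let enorm_ctr j : enorm (ctr j) = rad j.
Proof. by rewrite enormZ ?enorm_v0 ?mulr1 // ltW. Qed.

Let ball_annulus j x : ball j x -> 3 / 4 * rad j < enorm x < 5 / 4 * rad j.
Proof.
move=> bx; have xb : enorm (x - ctr j) < rad j / 4 by [].
apply/andP; split.
  have := enorm_triangle (ctr j - x) x; rewrite subrK enorm_ctr.
  by rewrite -opprB enormN; lra.
have := enorm_triangle (x - ctr j) (ctr j); rewrite subrK enorm_ctr; lra.
Qed.

Let ball_disjoint i j x : ball i x -> ball j x -> i = j.
Proof.
wlog: i j / (i <= j)%N.
  by move=> H bi bj; have [/H|/ltnW /H H'] := leqP i j; [exact|apply/esym/H'].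
rewrite leq_eqVlt => /predU1P [//|/rad_lt ij].
move=> bi bj; have /andP[a1 a2] := ball_annulus bi.
have /andP[b1 b2] := ball_annulus bj.
have : rad i < 0 by lra.
by rewrite ltNge (ltW (rad_gt0 i)).
Qed.

(** The annuli around the spheres of radius [rad j] that contain the balls are
    separated: [3 / 4 rad j] exceeds [5 / 4 rad j.+1]. *)
Let locally_one x : x != 0 -> exists (j : nat) (W : set V),
  [/\ open W, W x & forall y, W y -> forall i, i <> j -> ~ ball i y].
Proof.
move=> x0; have nx := enorm_gt0 x0.
have ex : exists j, rad j / 2 < enorm x.
  pose k := Num.truncn (tau / enorm x); exists k.+1.
  have k1 : tau / enorm x < k.+1%:R by exact: truncnS_gt.
  have k4 : k.+1%:R <= 4 ^+ k.+1 :> R by rewrite -natrX ler_nat ltnW // ltn_expl.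
  have r1 : rad k.+1 < enorm x.
    rewrite /rad ltr_pdivrMr ?exprn_gt0 // mulrC -ltr_pdivrMr //.
    exact: lt_le_trans k4.
  by apply: lt_trans r1; rewrite ltr_pdivrMr // ltr_pMr // ltr1n.
pose j := ex_minn ex.
have [jx jmin] : rad j / 2 < enorm x /\ forall i, rad i / 2 < enorm x -> (j <= i)%N.
  by rewrite /j; case: ex_minnP.
(* No annulus lies outside the first one; there any bound above [enorm x]
   will do. *)
pose b := if j == 0%N then enorm x + 1 else 3 * rad j.
have xb : enorm x < b.
  rewrite /b; case: ifPn => [_|j0]; first by rewrite ltrDl.
  rewrite ltNge; apply/negP => bx.
  have jj : (j.-1 < j)%N by rewrite prednK // lt0n.
  have : (j <= j.-1)%N; last by rewrite leqNgt jj.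
  apply: jmin.
  have -> : rad j.-1 = 4 * rad j by rewrite radS prednK // lt0n.
  by move: (rad_gt0 j) bx; move: (rad j) => r; lra.
pose N (y : V) := dotv (y - 0) (y - 0).
have NE y : N y = enorm y ^+ 2 by rewrite /N subr0 enorm_sqr.
have cN : continuous N by move=> y; exact: Ck_cont (Coo_sqdist 0 0%N) y I.
pose W := ([set y | (rad j / 2) ^+ 2 < N y] `&` [set y | N y < b ^+ 2])%classic.
have b0 : 0 < b by apply: lt_trans xb.
have WE y : W y <-> rad j / 2 < enorm y < b.
  have r2 : 0 <= rad j / 2 by rewrite ltW // divr_gt0.
  rewrite /W /= !NE !ltr_pXn2r ?nnegrE ?enorm_ge0 ?r2 ?(ltW b0) //.
  by split=> [[-> ->]|/andP].
exists j, W; split.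
- have oN D : open D -> open (N @^-1` D)%classic.
    by move=> oD; apply: open_comp oD => y _; exact: cN.
  have o1 := oN _ (@open_gt R ((rad j / 2) ^+ 2)); have o2 := oN _ (@open_lt R (b ^+ 2)).
  by have := openI o1 o2.
- by apply/WE; rewrite jx xb.
- move=> y /WE /andP[y1 y2] i ij /ball_annulus /andP[a1 a2].
  have [ltij|ltji|//] := ltngtP i j.
    have := rad_lt ltij; move: y2; rewrite /b ifF; last by apply/eqP => j0; rewrite j0 in ltij.
    by have := rad_gt0 j; lra.
  by have := rad_lt ltji; have := rad_gt0 j; lra.
Qed.

Lemma bubble_family : exists Kf uf : nat -> V -> R, forall j,
  bubble_spec (ctr j) (rad j / 4) (j.+1%:R * rad j `^ ((2 - n%:R) / 2))
              (Kf j) (uf j).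
Proof.
have /choice [KU HKU] : forall j, exists KU : (V -> R) * (V -> R),
    bubble_spec (ctr j) (rad j / 4) (j.+1%:R * rad j `^ ((2 - n%:R) / 2)) KU.1 KU.2.
  move=> j; have c1 : enorm (ctr j) <= 1.
    rewrite enorm_ctr (le_trans (rad_le j)) // ge_min invf_le1 ?ltr0n //.
    by rewrite ler1n.
  have r4 : 0 < rad j / 4 by rewrite divr_gt0.
  by have [K [u H]] := bubble_exists (j.+1%:R * rad j `^ ((2 - n%:R) / 2)) r4 c1;
    exists (K, u).
by exists (fun j => (KU j).1), (fun j => (KU j).2).
Qed.

Variables Kf uf : nat -> V -> R.
Hypothesis HB : forall j, bubble_spec (ctr j) (rad j / 4)
  (j.+1%:R * rad j `^ ((2 - n%:R) / 2)) (Kf j) (uf j).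

(** The balls are disjoint, so this is the index of the ball around [x]; any
    index will do when there is none. *)
Let idx x : nat := xget 0%N [set j | ball j x]%classic.

Let Kg x := Kf (idx x) x.
Let ug x := uf (idx x) x.

Let out j x : ~ ball j x -> uf j x = background x /\ Kf j x = 1.
Proof.
by move=> xj; apply: (bubble_spec_far (HB j)); rewrite leNgt; apply/negP.
Qed.

Let idx_ball j x : ball j x -> idx x = j.
Proof.
by move=> bj; rewrite /idx; apply: xget_unique => // i bi; exact: ball_disjoint bi bj.
Qed.

Let glueE j x : (forall i, i <> j -> ~ ball i x) -> Kg x = Kf j x /\ ug x = uf j x.
Proof.
move=> H; rewrite /Kg /ug; have [bj|bj] := pselect (ball j x).
  by rewrite (idx_ball bj).
have no i : ~ ball i x by have [->//|/eqP /H] := eqVneq i j.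
by have [-> ->] := out (no (idx x)); have [-> ->] := out bj.
Qed.

(** Two different perturbations vanish on each other's balls, so their
    increments add up. *)
Let Kg_lipschitz x y : `|Kg x - Kg y| <= 4 * enorm (x - y).
Proof.
have E := enorm_ge0 (x - y).
have [ij|/eqP ij] := eqVneq (idx x) (idx y).
  rewrite /Kg -ij; apply: le_trans (bubble_spec_lip (HB _) x y) _; lra.
have [_ Ky] : uf (idx x) y = background y /\ Kf (idx x) y = 1.
  by apply: out => /idx_ball H; apply: ij.
have [_ Kx] : uf (idx y) x = background x /\ Kf (idx y) x = 1.
  by apply: out => /idx_ball H; apply: ij.
have -> : Kg x - Kg y =
    (Kf (idx x) x - Kf (idx x) y) + (Kf (idx y) x - Kf (idx y) y).
  by rewrite Ky Kx /Kg; ring.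
apply: le_trans (ler_normD _ _) _.
have := bubble_spec_lip (HB (idx x)) x y; have := bubble_spec_lip (HB (idx y)) x y.
lra.
Qed.

(** The distance from [x] to the sphere bounding the ball controls [Kf j - 1],
    which vanishes there. *)
Let Kf_close j x : `|Kf j x - 1| <= tau.
Proof.
have [bx|/out [_ ->]] := pselect (ball j x); last by rewrite subrr normr0 ltW.
pose y := ctr j + (rad j / 4) *: v0.
have r4 : 0 <= rad j / 4 by rewrite divr_ge0 // ltW.
have [|_ <-] := bubble_spec_far (HB j) (x := y).
  by rewrite /y addrC addKr enormZ // enorm_v0 mulr1.
apply: le_trans (bubble_spec_lip (HB j) x y) _.
have -> : x - y = (x - ctr j) + - ((rad j / 4) *: v0) by rewrite /y opprD addrA.
have := enorm_triangle (x - ctr j) (- ((rad j / 4) *: v0)).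
rewrite enormN enormZ // enorm_v0 mulr1 => T.
have b1 : enorm (x - ctr j) < rad j / 4 by [].
by move: (rad_le j) T b1 => H1 H2 H3; lra.
Qed.

Let Kg0 : Kg 0 = 1.
Proof.
have [] := @out (idx 0) 0 => //= /ball_annulus /andP[H _].
by move: H; rewrite enormE /dotv big1 ?sqrtr0 => [|i _]; [have := rad_gt0 (idx 0); lra|rewrite mxE mul0r].
Qed.

Let smooth_glue (f : nat -> V -> R) : (forall j, Coo (@frame R n) setT (f j)) ->
  (forall j x, (forall i, i <> j -> ~ ball i x) -> f (idx x) x = f j x) ->
  smooth_on (punctured R n) (fun x => f (idx x) x).
Proof.
move=> Cf fE; apply: smooth_onP => k; apply: Ck_local => x x0.
have [j [W [oW Wx Wj]]] := locally_one x0; exists W; split=> //.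
apply: Ck_ext (Ck_sub _ (Cf j k)) => // y Wy.
by rewrite (fE j) // => i; exact: Wj.
Qed.

Lemma glued_solution : exists K : V -> R,
    [/\ smooth_on (punctured R n) K,
        forall x : V, x != 0 -> 0 < K x,
        forall x : V, x != 0 -> `|K x - 1| <= eps,
        K 0 = 1
      & exists C : R, 0 < C /\
          forall x y : V, `|K x - K y| <= C * enorm (x - y)]
    /\ exists u : V -> R, blow_up_solution K u.
Proof.
have close x : `|Kg x - 1| <= tau by exact: Kf_close.
exists Kg; split; first split.
- apply: smooth_glue => [j|j x H]; first exact: bubble_spec_K (HB j).
  by have [] := glueE H.
- move=> x _; have := close x; rewrite ler_norml => /andP[H _].
  have : tau <= 2^-1 by rewrite ge_min lexx.
  lra.
- by move=> x _; apply: le_trans (close x) _; rewrite ge_min lexx orbT.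
- exact: Kg0.
- by exists 4; split=> // x y; exact: Kg_lipschitz.
exists ug; split; first split.
- apply: smooth_glue => [j|j x H]; first exact: bubble_spec_u (HB j).
  by have [] := glueE H.
- by move=> x _; exact: (bubble_spec_gt0 (HB _)).
- move=> x x0; have [j [W [oW Wx Wj]]] := locally_one x0.
  have [-> ->] := glueE (Wj x Wx).
  rewrite (laplacian_near oW Wx (g := uf j)); first exact: (bubble_spec_eq (HB j)).
  by move=> y Wy; have [] := glueE (Wj y Wy).
move=> [C [C0 [r [r0 H]]]].
pose k := Num.truncn (C + tau / r).
have k1 : C + tau / r < k.+1%:R by exact: truncnS_gt.
have tr : 0 < tau / r by rewrite divr_gt0.
have k4 : k%:R + 1 <= 4 ^+ k :> R by rewrite natr1 -natrX ler_nat ltn_expl.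
have rk : rad k < r.
  rewrite /rad ltr_pdivrMr ?exprn_gt0 // mulrC -ltr_pdivrMr //.
  by move: k1; rewrite -natr1; lra.
have c0 : ctr k != 0.
  apply/eqP => c0; have := rad_gt0 k; rewrite -enorm_ctr c0.
  by rewrite enormE /dotv big1 ?sqrtr0 ?ltxx // => i _; rewrite mxE mul0r.
have bk : ball k (ctr k).
  rewrite /ball /= subrr enormE /dotv big1 => [|i _]; last by rewrite mxE mul0r.
  by rewrite sqrtr0 divr_gt0.
have := H (ctr k) c0; rewrite enorm_ctr => /(_ rk).
have -> : ug (ctr k) = uf k (ctr k) by rewrite /ug (idx_ball bk).
apply/negP; rewrite -ltNge; apply: lt_le_trans (bubble_spec_peak (HB k)).
by rewrite ltr_pM2r ?powR_gt0 //; lra.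
Qed.

End Gluing.

Theorem mainTheorem2 (R : realType) (n : nat) (hn : (4 < n)%N)
    (eps : R) (heps : 0 < eps) :
  exists K : 'rV[R]_n -> R,
    [/\ smooth_on (punctured R n) K,
        forall x : 'rV[R]_n, x != 0 -> 0 < K x,
        forall x : 'rV[R]_n, x != 0 -> `|K x - 1| <= eps,
        K 0 = 1
      & exists C : R, 0 < C /\
          forall x y : 'rV[R]_n, `|K x - K y| <= C * enorm (x - y)]
    /\ exists u : 'rV[R]_n -> R, blow_up_solution K u.
Proof.
have [Kf [uf HB]] := bubble_family hn heps.
exact: glued_solution HB.
Qed.
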